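(* Let $(S_n)_{n\ge0}$ be a tampered memory elephant random walk (TMERW) with parameters $p,\lambda\in[0,1]$, whose memory sets $\mathcal{D}=(D_n)_{n\ge1}$ form a collection of nested sequences having an underlying renewal structure. Then, almost surely as $n\to\infty$, $S_n\to+\infty$ if $\lambda>\frac12$, and $S_n\to-\infty$ if $\lambda<\frac12$. In particular $S_n$ is transient when $\lambda\ne\frac12$.
   Context: TMERW: Fix $p,\lambda\in[0,1]$. Let $\mathcal{D}=(D_n)_{n\ge1}$ be a sequence of (deterministic or random) sets with $D_n\subseteq\{1,\dots,n\}$, and let $D_n^c=\{1,\dots,n\}\setminus D_n$. Let $X_1$ be a random variable with values in $\{-1,+1\}$ (arbitrary law); let $(Y_n)_{n\ge2}$ be i.i.d. with $P(Y_n=1)=1-P(Y_n=-1)=\lambda$ (the innovations); let $(\varepsilon_n)_{n\ge2}$ be i.i.d. with $P(\varepsilon_n=1)=1-P(\varepsilon_n=-1)=p$; let $(I_{n+1})_{n\ge1}$ be independent with $I_{n+1}$ uniform on $\{1,\dots,n\}$. The objects $X_1$, $\mathcal{D}$, $(Y_n)$, $(\varepsilon_n)$, $(I_n)$ are mutually independent. For $n\ge1$ define recursively $X_{n+1}=\varepsilon_{n+1}X_{I_{n+1}}$ if $I_{n+1}\notin D_n$, and $X_{n+1}=Y_{n+1}$ if $I_{n+1}\in D_n$. The TMERW is $S_0=0$, $S_n=X_1+\dots+X_n$. Transient means that almost surely every site of $\mathbb{Z}$ is visited only finitely often. Nested sequences with renewal structure: Let $(L_n)_{n\ge1}$ be a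 stochastic process with values in $\{0,1\}$, $L_1\equiv1$, and let $D_n^c=\{j\le n: L_j=1\}$, $D_n=\{j\le n: L_j=0\}$. Let $\mu_0=0$. Recursively, for $k\ge0$: if $\mu_k<\infty$, let $\tau_{k+1}=\inf\{n>\mu_k: L_{n+1}=0\}-\mu_k$, with value $\infty$ if the set is empty; if $\mu_k=\infty$, let $\tau_{k+1}=0$. If $\mu_k<\infty$ and $\tau_{k+1}<\infty$, let $\sigma_{k+1}=\inf\{n>\mu_k+\tau_{k+1}: L_{n+1}=1\}-\mu_k-\tau_{k+1}$, with value $\infty$ if the set is empty; otherwise let $\sigma_{k+1}=0$. Put $\mu_{k+1}=\mu_k+\tau_{k+1}+\sigma_{k+1}$. (So $\tau_k,\sigma_k$ are the lengths of the successive runs of 1's and of 0's.) The collection $\mathcal{D}$ has an underlying renewal structure if: (A1) $(\tau_n)_{n\ge1}$ is i.i.d., $(\sigma_n)_{n\ge1}$ is i.i.d., and the two sequences are independent of each other; $\tau,\sigma$ denote generic variables with the laws of $\tau_n,\sigma_n$; (A2) there exists $\delta>0$ such that $E[e^{t\tau}]<\infty$ and $E[e^{t\sigma}]<\infty$ for all $t\in(-\delta,\delta)$. *)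

(* Defs.v *)
From HB Require Import structures.
From mathcomp Require Import all_boot all_order all_algebra.
From mathcomp Require Import finmap.
From mathcomp Require Import all_classical all_reals all_analysis.
From mathcomp Require Import measurable_realfun.

Set Implicit Arguments.
Unset Strict Implicit.
Unset Printing Implicit Defensive.

Import Order.TTheory GRing.Theory Num.Theory.
Import numFieldNormedType.Exports.

Local Open Scope classical_set_scope.
Local Open Scope ring_scope.

Section independence.
Context {R : realType} {d : measure_display} {T : measurableType d}.
Variable P : probability T R.

(* Mutual independence of the classes of events F i, i in K: the product rule
   for every finite subfamily. *)
Definition mutual_independence {I : choiceType} (K : set I)
    (F : I -> set (set T)) : Prop :=
  (forall i, K i -> F i `<=` measurable) /\
  forall (J : {fset I}) (E : I -> set T),
    [set` J] `<=` K -> (forall i, i \in J -> F i (E i)) ->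
    P (\bigcap_(i in [set` J]) E i) = (\prod_(i <- J) P (E i))%E.

Context {d' : measure_display} {U : measurableType d'}.

Definition sigma_rv (Z : T -> U) : set (set T) :=
  preimage_set_system setT Z measurable.

Definition sigma_process (K : set nat) (Z : nat -> T -> U) : set (set T) :=
  <<s \bigcup_(k in K) sigma_rv (Z k) >>.

Definition iid (K : set nat) (Z : nat -> T -> U) : Prop :=
  mutual_independence K (fun k => sigma_rv (Z k)) /\
  forall m n, K m -> K n -> forall B : set U, measurable B ->
    P (Z m @^-1` B) = P (Z n @^-1` B).

End independence.

Section tmerw.
Context {R : realType} {d : measure_display} {T : measurableType d}.
Variable P : probability T R.

(* D n w is the value at w of the random subset D_n of {1, ..., n}; the
   sigma-algebra of the sequence is generated by the events {j \in D_n}. *)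
Definition sigma_sets (D : nat -> T -> set nat) : set (set T) :=
  <<s [set A | exists n j, (1 <= n)%N /\ A = [set w | D n w j]] >>.

Definition sign_law (q : R) (Z : T -> R) : Prop :=
  P (Z @^-1` [set 1]) = q%:E /\ P (Z @^-1` [set (-1)]) = (1 - q)%:E.

(* All sequences are indexed by nat; X and D are used from index 1, and
   Y, eps, I from index 2. *)
Record is_TMERW (p lambda : R) (D : nat -> T -> set nat)
    (X Y eps : nat -> {RV P >-> R}) (I : nat -> {RV P >-> nat}) : Prop := {
  tmerw_memory : forall n w, (1 <= n)%N ->
    D n w `<=` [set j | (1 <= j <= n)%N] ;
  tmerw_first : forall w, X 1%N w = 1 \/ X 1%N w = -1 ;
  tmerw_Y_iid : iid P [set n | (2 <= n)%N] Y ;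
  tmerw_Y_law : forall n, (2 <= n)%N -> sign_law lambda (Y n) ;
  tmerw_eps_iid : iid P [set n | (2 <= n)%N] eps ;
  tmerw_eps_law : forall n, (2 <= n)%N -> sign_law p (eps n) ;
  tmerw_I_indep :
    mutual_independence P [set n | (2 <= n)%N] (fun n => sigma_rv (I n)) ;
  tmerw_I_law : forall n j, (1 <= j <= n)%N ->
    P (I n.+1 @^-1` [set j]) = (n%:R^-1)%:E ;
  tmerw_indep : mutual_independence P [set: 'I_5]
    (tnth [tuple sigma_rv (X 1%N);
                 sigma_sets D;
                 sigma_process [set n | (2 <= n)%N] Y;
                 sigma_process [set n | (2 <= n)%N] eps;
                 sigma_process [set n | (2 <= n)%N] I]) ;
  tmerw_step_out : forall n w, (1 <= n)%N -> ~ D n w (I n.+1 w) ->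
    X n.+1 w = eps n.+1 w * X (I n.+1 w) w ;
  tmerw_step_in : forall n w, (1 <= n)%N -> D n w (I n.+1 w) ->
    X n.+1 w = Y n.+1 w
}.

Definition walk (X : nat -> T -> R) (n : nat) (w : T) : R :=
  \sum_(1 <= k < n.+1) X k w.

Definition transient (S : nat -> T -> R) : Prop :=
  {ae P, forall w, forall z : int, finite_set [set n | S n w = z%:~R]}.

End tmerw.

Section runs.
Context {R : realType}.
Local Open Scope ereal_scope.

(* l is one trajectory of the process L, with true for 1 and false for 0.
   Times and run lengths are extended reals, and ereal_inf set0 = +oo. *)
Variable l : nat -> bool.

Definition next_tau (mu : \bar R) : \bar R :=
  if mu < +oo then
    ereal_inf [set n%:R%:E | n in [set n : nat | mu < n%:R%:E /\ l n.+1 = false]]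
    - mu
  else 0.

Definition next_sigma (mu : \bar R) : \bar R :=
  if (mu < +oo) && (next_tau mu < +oo) then
    ereal_inf [set n%:R%:E | n in
      [set n : nat | mu + next_tau mu < n%:R%:E /\ l n.+1 = true]]
    - mu - next_tau mu
  else 0.

Fixpoint run_mu (k : nat) : \bar R :=
  if k is k'.+1
  then run_mu k' + next_tau (run_mu k') + next_sigma (run_mu k')
  else 0.

(* Meaningful for k >= 1. *)
Definition run_tau (k : nat) : \bar R := next_tau (run_mu k.-1).
Definition run_sigma (k : nat) : \bar R := next_sigma (run_mu k.-1).

End runs.

Section renewal.
Context {R : realType} {d : measure_display} {T : measurableType d}.
Variable P : probability T R.

Definition exp_moments (Z : T -> \bar R) : Prop :=
  exists2 delta : R, 0 < delta & forall t : R, - delta < t < delta ->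
    (\int[P]_w expeR (t%:E * Z w) < +oo)%E.

Definition nested_renewal (D : nat -> T -> set nat) : Prop :=
  exists L : nat -> {RV P >-> bool},
    let tau k w : \bar R := run_tau (fun j => L j w) k in
    let sigma k w : \bar R := run_sigma (fun j => L j w) k in
    [/\ forall w, L 1%N w = true,
        forall n w, (1 <= n)%N ->
          D n w = [set j | (1 <= j <= n)%N /\ L j w = false],
        [/\ iid P [set k | (1 <= k)%N] tau,
            iid P [set k | (1 <= k)%N] sigma
          & mutual_independence P [set: 'I_2]
              (tnth [tuple sigma_process [set k | (1 <= k)%N] tau;
                           sigma_process [set k | (1 <= k)%N] sigma])]
      & exp_moments (tau 1%N) /\ exp_moments (sigma 1%N)].

End renewal.

(* Main.v *)
(* Let q = 2p - 1, m = 2 lambda - 1, L_j = 1 when j lies outside D_n, n >= j, and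
   let r_n be the average of q L_j X_j + m (1 - L_j) over j <= n, which is the
   conditional mean of X_(n+1) given D and X_1, ..., X_n. The variables
   X_(n+1) - r_n, and also L_(n+1) (X_(n+1) - r_n), are bounded and pairwise
   orthogonal, hence obey the strong law of large numbers (second moments along
   squares). The same law applied to the run lengths gives
   (L_1 + ... + L_n) / n --> al = E tau / (E tau + E sigma) < 1. As r_n moves by
   O(1/n), Abel summation lets L_j be replaced by al in averages against
   r_(j-1), so s_n = S_n / n satisfies
   s_n = q al (s_0 + ... + s_(n-1)) / n + m (1 - al) + o(1).
   Since |q al| < 1 this forces s_n --> m (1 - al) / (1 - al q), whose sign is
   that of lambda - 1/2.

   No conditional expectation is used: up to time n everything is, almost
   surely, a linear combination of indicators of cylinder events, on which the
   product rule can be applied directly. *)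
Require Import Defs.
From HB Require Import structures.
From mathcomp Require Import all_boot all_order all_algebra.
From mathcomp Require Import finmap.
From mathcomp Require Import all_classical all_reals all_analysis.
From mathcomp Require Import measurable_realfun.
From mathcomp Require Import zify ring lra.

Set Implicit Arguments.
Unset Strict Implicit.
Unset Printing Implicit Defensive.

Import Order.TTheory GRing.Theory Num.Theory.
Import numFieldNormedType.Exports.

Local Open Scope classical_set_scope.
Local Open Scope ring_scope.

(** * Averages *)

Section averages.
Context {R : realType}.
Implicit Types (u v r x l : nat -> R).

(** Two noises are needed because the drift sees the past only through its marked steps: r_n
    contains the average of L_j X_j, not s_n. The noise weighted by L trades that average for the
    one of L_j r_(j-1), where the slow variation of r separates the two factors; the plain noise
    then turns averages of r back into s_n. The weighted noise stays orthogonal because [D] is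
    independent of all innovations: its whole trajectory, future included, may count as known at
    time n, so L_(n+1) is a legitimate factor of a test function at time n.

    The bound |q al| < 1 cannot come from q, which may be 1 or -1. It comes from al < 1, that is,
    from every run of zeros having length at least one.

    The laws of Y, eps and I fix their values only up to null sets. Moments are therefore computed
    for a copy of X that is bounded everywhere and agrees with X on a set of full measure. *)

Definition avg u (n : nat) : R := n%:R^-1 * \sum_(1 <= k < n.+1) u k.

Lemma avg0 u : avg u 0 = 0. Proof. by rewrite /avg invr0 mul0r. Qed.

Lemma avgS u n : n.+1%:R * avg u n.+1 = n%:R * avg u n + u n.+1.
Proof.
rewrite /avg mulrA divff ?pnatr_eq0// mul1r big_nat_recr//=.
case: n => [|n]; first by rewrite big_geq// invr0 !mul0r.
by rewrite mulrA divff ?pnatr_eq0// mul1r.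
Qed.

Lemma avgD u v n : avg (fun k => u k + v k) n = avg u n + avg v n.
Proof. by rewrite /avg big_split/= mulrDr. Qed.

Lemma avgZ a u n : avg (fun k => a * u k) n = a * avg u n.
Proof. by rewrite /avg -mulr_sumr mulrCA. Qed.

Lemma avgB u v n : avg (fun k => u k - v k) n = avg u n - avg v n.
Proof. by rewrite /avg sumrB mulrBr. Qed.

Lemma avg_cst a n : (0 < n)%N -> avg (fun=> a) n = a.
Proof.
case: n => // n _; rewrite /avg sumr_const_nat subSS subn0 -[a *+ _]mulr_natl mulrA.
by rewrite mulVf ?pnatr_eq0// mul1r.
Qed.

Lemma eq_avg u v n : (forall k, (0 < k)%N -> u k = v k) -> avg u n = avg v n.
Proof.
move=> uv; congr (_ * _); rewrite big_nat_cond [RHS]big_nat_cond.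
by apply: eq_bigr => k /andP[/andP[k0 _] _]; exact: uv.
Qed.

Lemma ler_norm_avg u v n : (forall k, (0 < k)%N -> `|u k| <= v k) ->
  `|avg u n| <= avg v n.
Proof.
move=> uv; rewrite normrM ger0_norm ?invr_ge0// ler_wpM2l ?invr_ge0//.
rewrite (le_trans (ler_norm_sum _ _ _))// big_nat_cond [leRHS]big_nat_cond.
by apply: ler_sum => k /andP[/andP[k0 _] _]; exact: uv.
Qed.

Lemma avg_le_cst u (C : R) n : 0 <= C -> (forall k, `|u k| <= C) ->
  `|avg u n| <= C.
Proof.
move=> C0 uC; case: n => [|n]; first by rewrite avg0 normr0.
by rewrite -[leRHS](@avg_cst C n.+1)//; apply: ler_norm_avg.
Qed.

Lemma cvg_avg u (a : R) : u @ \oo --> a -> avg u @ \oo --> a.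
Proof.
move=> ua; rewrite -cvg_shiftS.
have : arithmetic_mean (fun k => u k.+1) @ \oo --> a.
  by apply: cesaro; rewrite (cvg_shiftS u).
apply: cvg_trans; apply: near_eq_cvg; near=> n => /=.
by rewrite /avg /series/= big_add1.
Unshelve. all: by end_near. Qed.

Lemma cvg0_le_norm u v : (forall n, `|u n| <= v n) ->
  v @ \oo --> (0 : R) -> u @ \oo --> (0 : R).
Proof.
move=> uv v0; apply: (@squeeze_cvgr _ _ _ _ (- v) v) => //.
  by near=> n; rewrite -ler_norml uv.
by rewrite -[X in _ --> X]oppr0; exact: cvgN.
Unshelve. all: by end_near. Qed.

Lemma cvg0_mul_bounded u v (C : R) : (forall n, `|v n| <= C) ->
  u @ \oo --> (0 : R) -> (fun n => u n * v n) @ \oo --> (0 : R).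
Proof.
move=> vC u0; apply: (@cvg0_le_norm _ (fun n => `|u n| * C)).
  by move=> n; rewrite normrM ler_wpM2l.
rewrite -[X in _ --> X](mul0r C); apply: cvgMl.
by rewrite -[X in _ --> X](@normr0 _ R); exact: cvg_norm.
Qed.

Lemma cvg_prev u (a : R) : u @ \oo --> a -> (fun k => u k.-1) @ \oo --> a.
Proof. by move=> ua; rewrite -cvg_shiftS. Qed.

(* Abel summation: [r] varies slowly, so it behaves as a constant factor. *)
Lemma cvg_avg_slow u r (B C : R) : 0 <= C ->
  (forall k, `|r k| <= B) ->
  (forall k, `|r k.+1 - r k| <= C / k.+1%:R) ->
  avg u @ \oo --> (0 : R) ->
  avg (fun k => u k * r k.-1) @ \oo --> (0 : R).
Proof.
move=> C0 rB rC u0.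
(* Abel's identity divided by n: [k%:R * avg u k] is a partial sum of [u], and its factor k is later
   cancelled by the 1/k in the increment bound on [r]. *)
have abel n : avg (fun k => u k * r k.-1) n =
    avg u n * r n - avg (fun k => k%:R * avg u k * (r k - r k.-1)) n.
  have [->|n0] := eqVneq n 0; first by rewrite !avg0 mul0r subr0.
  apply: (@mulfI _ n%:R); first by rewrite pnatr_eq0.
  rewrite mulrBr [n%:R * (avg u n * _)]mulrA; elim: n {n0} => [|n ih].
    by rewrite !avg0 !(mulr0, mul0r) subr0.
  rewrite [LHS]avgS ih (avgS (fun k => k%:R * avg u k * _)) /= (avgS u).
  ring.
have -> : avg (fun k => u k * r k.-1) =
  (fun n => avg u n * r n - avg (fun k => k%:R * avg u k * (r k - r k.-1)) n).
  by apply/funext.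
rewrite -[X in _ --> X]subr0; apply: cvgB; first exact: cvg0_mul_bounded u0.
apply: cvg_avg; apply: (@cvg0_le_norm _ (fun k => `|avg u k| * C)).
  move=> [|k]; first by rewrite avg0 !(mulr0, mul0r, normr0).
  rewrite !normrM (normr_nat _ k.+1) mulrAC mulrC/= ler_wpM2l// mulrC.
  by rewrite -ler_pdivlMr.
rewrite -[X in _ --> X](mul0r C); apply: cvgMl.
by rewrite -[X in _ --> X](@normr0 _ R); exact: cvg_norm.
Qed.

(** An eventual bound M on |u| passes to the averages up to a vanishing error, hence improves to c
    M; iteration gives the bounds [c ^+ j * B']. The midpoint c of |b| and 1 leaves room for the
    error. *)
Lemma cvg0_contraction u (b B : R) : `|b| < 1 -> (forall n, `|u n| <= B) ->
  (fun n => u n - b * avg (fun k => u k.-1) n) @ \oo --> (0 : R) ->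
  u @ \oo --> (0 : R).
Proof.
move=> b1 uB ub0.
(* The maximum with 1 makes the starting bound positive, as the error allowed in [step] is
   proportional to M. *)
pose B' := Num.max B 1; pose c := (1 + `|b|) / 2.
have c0 : 0 <= c by rewrite /c; have := normr_ge0 b; lra.
have c1 : c < 1 by rewrite /c; lra.
have bc : `|b| < c by rewrite /c; lra.
have step M : 0 < M -> (\forall n \near \oo, `|u n| <= M) ->
    \forall n \near \oo, `|u n| <= c * M.
  move=> M0 uM.
  (* The excess over M vanishes from some index on, so its average tends to 0: the early terms that
     may violate the bound are forgotten. *)
  pose w k := Num.max (`|u k.-1| - M) 0.
  have w0 : w @ \oo --> (0 : R).
    apply: cvg_near_cst; case: uM => N _ uM; exists N.+1 => // n /= Nn.
    apply/eqP; rewrite /w max_r// subr_le0; apply: uM => /=; lia.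
  (* Chosen so that [|b| * M + 2 * e = c * M]. *)
  pose e := (c - `|b|) * M / 2.
  have e0 : 0 < e by rewrite /e divr_gt0// mulr_gt0// subr_gt0.
  have wM n : `|avg (fun k => u k.-1) n| <= M + avg w n.
    case: n => [|n]; first by rewrite !avg0 normr0 addr0 ltW.
    rewrite -[in leRHS](@avg_cst M n.+1)// -avgD; apply: ler_norm_avg => k _.
    by rewrite -lerBlDl /w le_max lexx.
  have := @cvg_avg _ _ w0.
  move=> /cvgrPdist_le/(_ _ e0) H1.
  move/cvgrPdist_le : ub0 => /(_ _ e0) H2.
  near=> n.
  have H1n : `|0 - avg w n| <= e by near: n.
  have H2n : `|0 - (u n - b * avg (fun k => u k.-1) n)| <= e by near: n.
  rewrite sub0r normrN in H1n; rewrite sub0r normrN in H2n.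
  have h1 : `|u n| <= e + `|b| * `|avg (fun k => u k.-1) n|.
    rewrite -normrM -[u n](subrK (b * avg (fun k => u k.-1) n)).
    by rewrite (le_trans (ler_normD _ _))// lerD2r.
  have h2 : `|b| * `|avg (fun k => u k.-1) n| <= `|b| * (M + e).
    rewrite ler_wpM2l// (le_trans (wM n))// lerD2l.
    by rewrite (le_trans (ler_norm _)).
  have h3 : `|b| * e <= e by rewrite ler_piMl// ltW.
  rewrite (le_trans h1)// (le_trans (lerD (lexx e) h2))//.
  rewrite mulrDr.
  have -> : c * M = e + (`|b| * M + e) by rewrite /e; field.
  by rewrite lerD2l lerD2l.
have B'0 : 0 < B' by rewrite /B' lt_max ltr01 orbT.
have geo j : \forall n \near \oo, `|u n| <= c ^+ j * B'.
  elim: j => [|j ih].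
    by near=> n; rewrite expr0 mul1r /B' le_max uB.
  rewrite exprS -mulrA; apply: step => //; rewrite mulr_gt0// exprn_gt0//.
  exact: le_lt_trans bc.
apply/cvgrPdist_le => e e0.
have : geometric B' c @ \oo --> (0 : R).
  by apply: cvg_geometric; rewrite ger0_norm.
move=> /cvgrPdist_le/(_ _ e0)[j _ /(_ j (leqnn j))/=].
rewrite sub0r normrN => hj.
near=> n; rewrite sub0r normrN (@le_trans _ _ (c ^+ j * B'))//.
  by near: n; exact: geo.
by rewrite mulrC (le_trans (ler_norm _)).
Unshelve. all: by end_near. Qed.

Lemma avg_step u (C : R) k : (forall j, `|u j| <= C) ->
  `|avg u k.+1 - avg u k| <= 2 * C / k.+1%:R.
Proof.
move=> uC; have C0 : 0 <= C := le_trans (normr_ge0 _) (uC 0%N).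
rewrite ler_pdivlMr// -[X in _ * X]ger0_norm// -normrM mulrBl.
rewrite mulrC avgS.
have -> : k%:R * avg u k + u k.+1 - avg u k * k.+1%:R = u k.+1 - avg u k.
  by rewrite -natr1; ring.
rewrite (le_trans (ler_normB _ _))// mulr_natl mulr2n lerD//.
exact: avg_le_cst.
Qed.

(** The deterministic core, on one trajectory. The average of l x is that of l (x - r'), plus that
    of (l - al) r', plus al times that of r', where r' is r at the previous index. The first two
    vanish and the average of r' is s up to noise, so r - q al s tends to m (1 - al). Averaging once
    more gives a contraction of factor q al for s minus its limit. *)
Lemma cvg_avg_tampered (al q m : R) l x :
  (forall k, `|l k| <= 1) -> (forall k, `|x k| <= 1) ->
  0 <= al < 1 -> `|q| <= 1 ->
  let r := avg (fun j => q * (l j * x j) + m * (1 - l j)) in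
  avg l @ \oo --> al ->
  avg (fun k => x k - r k.-1) @ \oo --> (0 : R) ->
  avg (fun k => l k * (x k - r k.-1)) @ \oo --> (0 : R) ->
  avg x @ \oo --> m * (1 - al) / (1 - al * q).
Proof.
move=> l1 x1 /andP[al0 al1] q1 r lal e1 e2.
set g := _ / _.
have alq : `|q * al| < 1.
  by rewrite normrM (ger0_norm al0) (le_lt_trans _ al1)// ler_piMl.
have alq' : 1 - al * q != 0.
  by rewrite subr_eq0 eq_sym; apply: contraTneq alq => h; rewrite mulrC h normr1 ltxx.
(* Only |l| <= 1 is assumed, whence 2 as the bound for |1 - l|. *)
pose C := `|q| + `|m| * 2.
have vC j : `|q * (l j * x j) + m * (1 - l j)| <= C.
  rewrite (le_trans (ler_normD _ _))// lerD// normrM ?ler_piMr//.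
    by rewrite normrM mulr_ile1.
  rewrite ler_wpM2l// (le_trans (ler_normB _ _))// normr1.
  by have := l1 j; lra.
have C0 : 0 <= C := le_trans (normr_ge0 _) (vC 0%N).
have rC k : `|r k| <= C by exact: avg_le_cst.
have E1 : avg (fun k => (l k - al) * r k.-1) @ \oo --> (0 : R).
  apply: (@cvg_avg_slow _ r C (2 * C)) => //; first by rewrite mulr_ge0.
    by move=> k; exact: avg_step.
  rewrite -[X in _ --> X](subrr al).
  have : (fun n => avg l n - al) @ \oo --> al - al by apply: cvgB => //; exact: cvg_cst.
  apply: cvg_trans; apply: near_eq_cvg; near=> n => /=.
  by rewrite avgB avg_cst//; near: n; exact: nbhs_infty_gt.
pose s := avg x.
pose e k := r k - q * al * s k - m * (1 - al).
have e0 : e @ \oo --> (0 : R).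
  have : (fun n => q * (avg (fun k => l k * (x k - r k.-1)) n
     + avg (fun k => (l k - al) * r k.-1) n
     - al * avg (fun k => x k - r k.-1) n) + m * (al - avg l n)) @ \oo -->
     q * (0 + 0 - al * 0) + m * (al - al).
    apply: cvgD; apply: cvgMr.
      by apply: cvgB; [exact: cvgD|exact: cvgMr].
    by apply: cvgB => //; exact: cvg_cst.
  rewrite !(subrr, mulr0, subr0, addr0).
  apply: cvg_trans; apply: near_eq_cvg; near=> n => /=.
  have n0 : (0 < n)%N by near: n; exact: nbhs_infty_gt.
  have rE : r n = q * avg (fun k => l k * x k) n + m * (1 - avg l n).
    by rewrite /r avgD (avgZ q) (avgZ m) avgB avg_cst.
  rewrite /e rE /s.
  have -> : avg (fun k => l k * (x k - r k.-1)) n =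
      avg (fun k => l k * x k) n - avg (fun k => l k * r k.-1) n.
    by rewrite -avgB; apply: eq_avg => k _; ring.
  have -> : avg (fun k => (l k - al) * r k.-1) n =
      avg (fun k => l k * r k.-1) n - al * avg (fun k => r k.-1) n.
    by rewrite -avgZ -avgB; apply: eq_avg => k _; ring.
  rewrite avgB; ring.
have s1 n : `|s n| <= 1 by exact: avg_le_cst.
suff : (fun n => s n - g) @ \oo --> (0 : R).
  move=> h; rewrite -[X in _ --> X](add0r g).
  have -> : avg x = (fun n => (s n - g) + g) by apply/funext => n; rewrite subrK.
  by apply: cvgD => //; exact: cvg_cst.
apply: (@cvg0_contraction _ (q * al) (1 + `|g|)) => //.
  by move=> n; rewrite (le_trans (ler_normB _ _))// lerD2r.
have : (fun n => avg (fun k => x k - r k.-1) n + avg (fun k => e k.-1) n) @ \oo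
    --> 0 + (0 : R).
  by apply: cvgD => //; apply/cvg_avg/cvg_prev.
rewrite addr0; apply: cvg_trans; apply: near_eq_cvg; near=> n => /=.
have n0 : (0 < n)%N by near: n; exact: nbhs_infty_gt.
rewrite /e !avgB !(avg_cst _ n0) avgZ /s.
(* The limit g is the fixed point of the averaged recursion. *)
have gE : g - q * al * g = m * (1 - al) by rewrite /g; field.
rewrite -gE; ring.
Unshelve. all: by end_near. Qed.

End averages.

(** * Averages along the squares *)

Section interpolation.
Context {R : realType}.
Implicit Type u : nat -> R.

Lemma natr_avg u n : n%:R * avg u n = \sum_(1 <= k < n.+1) u k.
Proof.
case: n => [|n]; first by rewrite mul0r big_geq.
by rewrite /avg mulrA divff ?pnatr_eq0// mul1r.
Qed.

Lemma natr_avg_sub u (B : R) m n : (m <= n)%N -> (forall k, - B <= u k) ->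
  m%:R * avg u m - (n - m)%:R * B <= n%:R * avg u n.
Proof.
move=> mn uB; rewrite -(subnK mn) addnC addKn; elim: (n - m)%N => [|j ih].
  by rewrite mul0r subr0 addn0.
rewrite addnS avgS -natr1 mulrDl mul1r opprD addrA.
exact: lerD.
Qed.

(** The gap between the two squares is [2 * k.+1 + 1], of the order of the square root of n, hence
    negligible after division by n. *)
Lemma sqr_bracket n k : (k.+1 ^ 2 <= n < k.+2 ^ 2)%N ->
  [/\ n - k.+1 ^ 2 <= 3 * k.+1, k.+2 ^ 2 - n <= 3 * k.+1,
      k.+1 * k.+1 <= n & k.+2 ^ 2 <= 4 * n]%N.
Proof.
have e : (k.+2 ^ 2 = k.+1 ^ 2 + 2 * k.+1 + 1)%N by rewrite -(addn1 k.+1) sqrnD; lia.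
have k2 : (k.+1 <= k.+1 ^ 2)%N by rewrite -[leqLHS]muln1 leq_mul2l.
rewrite (mulnn k.+1) e; move: k2; set s := (k.+1 ^ 2)%N; clearbody s.
by move=> k2 /andP[h1 h2]; split; lia.
Qed.

(* The lower bound on [u] makes the partial sums almost monotone, which
   controls them between consecutive squares. *)
Lemma cvg_avg_squares u (B : R) : (forall k, - B <= u k) ->
  (fun k => avg u (k.+1 ^ 2)%N) @ \oo --> (0 : R) -> avg u @ \oo --> (0 : R).
Proof.
move=> uB usq; pose B' := Num.max B 0.
have B'0 : 0 <= B' by rewrite /B' le_max lexx orbT.
have uB' k : - B' <= u k.
  by rewrite (le_trans _ (uB k))// lerN2 /B' le_max lexx.
apply/cvgrPdist_le => e e0.
(* The upper estimate costs four such terms from the next square, which is at most 4 n, and three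
   from the gap; the lower one costs four in all. Seven eighths of e suffice. *)
have e6 : 0 < e / 8 by rewrite divr_gt0.
move/cvgrPdist_le : usq => /(_ _ e6)[K1 _ HK1].
have [K2 HK2] : exists K2 : nat, B' / (e / 8) <= K2%:R.
  exists (Num.truncn (B' / (e / 8))).+1.
  by rewrite ltW// truncnS_gt.
exists ((K1 + K2).+2 ^ 2)%N => // n /= hn.
have [k [k1 k2]] : exists k, (k.+1 ^ 2 <= n)%N /\ (n < k.+2 ^ 2)%N.
  have exk : exists k, (n < k.+2 ^ 2)%N by exists n; nia.
  case: (ex_minnP exk) => k k2 kmin.
  have hk : (K1 + K2 < k)%N.
    rewrite ltnNge; apply/negP => kK.
    have : (k.+2 ^ 2 <= (K1 + K2).+2 ^ 2)%N by rewrite leq_exp2r.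
    lia.
  exists k; split=> //; rewrite leqNgt; apply/negP => nk.
  by case: k hk {k2} kmin nk => // k _ kmin /kmin; rewrite ltnn.
have hk : (K1 + K2 <= k)%N.
  rewrite -ltnS ltnNge; apply/negP => kK.
  have : (k.+2 ^ 2 <= (K1 + K2).+2 ^ 2)%N by rewrite leq_exp2r//; lia.
  lia.
have n0 : (0 < n)%N by lia.
have nR : (0 : R) < n%:R by rewrite ltr0n.
have a1 : `|avg u (k.+1 ^ 2)| <= e / 8.
  by have := HK1 k; rewrite /= sub0r normrN; apply; lia.
have a2 : `|avg u (k.+2 ^ 2)| <= e / 8.
  by have := HK1 k.+1; rewrite /= sub0r normrN; apply; lia.
have BK : B' <= k.+1%:R * (e / 8).
  move: HK2; rewrite ler_pdivrMr// => /le_trans; apply.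
  by rewrite ler_wpM2r ?(ltW e6)// ler_nat; lia.
have lo := natr_avg_sub k1 uB'.
have up := natr_avg_sub (ltnW k2) uB'.
have [b1 b2 b3 b4] : [/\ n - k.+1 ^ 2 <= 3 * k.+1, k.+2 ^ 2 - n <= 3 * k.+1,
    k.+1 * k.+1 <= n & k.+2 ^ 2 <= 4 * n]%N by apply: sqr_bracket; rewrite k1.
have d1 : (n - k.+1 ^ 2)%:R * B' <= 3 * k.+1%:R * B'.
  by rewrite ler_wpM2r// -natrM ler_nat.
have d2 : (k.+2 ^ 2 - n)%:R * B' <= 3 * k.+1%:R * B'.
  by rewrite ler_wpM2r// -natrM ler_nat.
have kB : k.+1%:R * B' <= n%:R * (e / 8).
  rewrite (@le_trans _ _ (k.+1%:R * (k.+1%:R * (e / 8))))//.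
    by rewrite ler_wpM2l.
  by rewrite mulrA -natrM ler_wpM2r ?(ltW e6)// ler_nat.
have k4 : ((k.+2 ^ 2)%:R : R) <= 4 * n%:R by rewrite -natrM ler_nat.
have k14 : ((k.+1 ^ 2)%:R : R) <= n%:R by rewrite ler_nat.
have s1 : (k.+1 ^ 2)%:R * `|avg u (k.+1 ^ 2)| <= n%:R * (e / 8).
  by rewrite ler_pM.
have s2 : (k.+2 ^ 2)%:R * `|avg u (k.+2 ^ 2)| <= 4 * n%:R * (e / 8).
  by rewrite ler_pM.
have t1 : (k.+1 ^ 2)%:R * (- `|avg u (k.+1 ^ 2)|) <=
    (k.+1 ^ 2)%:R * avg u (k.+1 ^ 2).
  by rewrite ler_wpM2l// lerNl -normrN ler_norm.
have t2 : (k.+2 ^ 2)%:R * avg u (k.+2 ^ 2) <=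
    (k.+2 ^ 2)%:R * `|avg u (k.+2 ^ 2)|.
  by rewrite ler_wpM2l// ler_norm.
rewrite sub0r normrN -(ler_pM2l nR) -[X in X * `|_|]ger0_norm// -normrM.
rewrite ler_norml; apply/andP; split; lra.
Qed.

(** Telescoping: [(a + 1) ^- 2] is below [a^-1 - (a + 1)^-1], and the subtracted term in the bound
    is what lets the induction close. *)
Lemma sum_inv_sqr n :
  \sum_(0 <= k < n.+1) (k.+1%:R ^+ 2)^-1 <= 2 - n.+1%:R^-1 :> R.
Proof.
elim: n => [|n ih]; first by rewrite big_nat1 expr1n invr1; lra.
rewrite big_nat_recr//= (le_trans (lerD ih (lexx _)))//.
have a0 : (0 : R) < n.+1%:R by rewrite ltr0n.
rewrite -[n.+2%:R]natr1; set a : R := n.+1%:R in a0 *.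
rewrite -subr_ge0.
have -> : 2 - (a + 1)^-1 - (2 - a^-1 + ((a + 1) ^+ 2)^-1) =
  (a * (a + 1) ^+ 2)^-1.
  by field; rewrite !gt_eqF// addr_gt0.
by rewrite invr_ge0 mulr_ge0 ?sqr_ge0// ltW.
Qed.

End interpolation.

(** * Strong laws of large numbers *)

Section slln.
Context {R : realType} {d : measure_display} {T : measurableType d}.
Variable P : probability T R.
Implicit Types f g : T -> R.

Local Notation "'E[ f ]" := (\int[P]_w f w) (f at level 99, format "''E[' f ]").
Local Notation itg f := (P.-integrable setT (EFin \o f)).

Lemma itg_le f g : measurable_fun setT f -> itg g ->
  (forall w, `|f w| <= g w) -> itg f.
Proof.
move=> mf ig fg; apply: (le_integrable measurableT _ _ ig) => [|w _/=].
  exact/measurable_EFinP.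
by rewrite lee_fin (le_trans (fg w))// ler_norm.
Qed.

Lemma itg_mul f g : measurable_fun setT f -> measurable_fun setT g ->
  itg (fun w => f w ^+ 2) -> itg (fun w => g w ^+ 2) ->
  itg (fun w => f w * g w).
Proof.
move=> mf mg if2 ig2; apply: (@itg_le _ (fun w => f w ^+ 2 + g w ^+ 2)).
- exact: measurable_funM.
- exact: (integrableD measurableT if2 ig2).
- move=> w; rewrite normrM -(real_normK (num_real (f w))).
  rewrite -(real_normK (num_real (g w))).
  have := normr_ge0 (f w); have := normr_ge0 (g w); nra.
Qed.

Lemma expectD f g : itg f -> itg g ->
  'E[fun w => f w + g w] = 'E[f] + 'E[g].
Proof. by move=> *; rewrite RintegralD. Qed.

Lemma expectZ a f : itg f -> 'E[fun w => a * f w] = a * 'E[f].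
Proof. by move=> *; rewrite RintegralZl. Qed.

Section orthogonal.
Variables (W : nat -> T -> R) (C : R).
Hypothesis mW : forall k, measurable_fun setT (W k).
Hypothesis iW : forall k, itg (fun w => W k w ^+ 2).
Hypothesis WC : forall k, 'E[fun w => W k w ^+ 2] <= C.
Hypothesis WW : forall i j, (0 < i < j)%N -> 'E[fun w => W i w * W j w] = 0.

Let S n w := \sum_(1 <= k < n.+1) W k w.

Let SS n w : S n.+1 w = S n w + W n.+1 w.
Proof. by rewrite /S big_nat_recr. Qed.

Let S0 w : S 0 w = 0. Proof. by rewrite /S big_geq. Qed.

Let mS n : measurable_fun setT (S n).
Proof. by apply: measurable_sum => k. Qed.

Let iS n : itg (fun w => S n w ^+ 2).
Proof.
elim: n => [|n ih].
  apply: (eq_integrable measurableT (cst 0)); last exact: integrable0.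
  by move=> w _ /=; rewrite S0 expr0n.
have iSW := itg_mul (mS n) (mW n.+1) ih (iW n.+1).
have := integrableD measurableT (integrableD measurableT ih iSW)
  (integrableD measurableT iSW (iW n.+1)).
apply: eq_integrable => // w _ /=.
by rewrite SS -!EFinD; congr EFin; ring.
Qed.

Let SW n j : (n < j)%N -> 'E[fun w => S n w * W j w] = 0.
Proof.
elim: n => [|n ih] nj.
  under eq_Rintegral do rewrite S0 mul0r.
  by rewrite Rintegral_cst// mul0r.
under eq_Rintegral do rewrite SS mulrDl.
rewrite expectD ?ih ?WW ?addr0//; last 3 first.
- exact: ltnW.
- exact: itg_mul (mS n) (mW j) (iS n) (iW j).
- exact: itg_mul (mW n.+1) (mW j) (iW n.+1) (iW j).
Qed.

Lemma expect_sum_sqr n : 'E[fun w => S n w ^+ 2] <= n%:R * C.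
Proof.
elim: n => [|n ih].
  under eq_Rintegral do rewrite S0 expr0n.
  by rewrite Rintegral_cst// !mul0r.
have iSW := itg_mul (mS n) (mW n.+1) (iS n) (iW n.+1).
have -> : 'E[fun w => S n.+1 w ^+ 2] =
   'E[fun w => S n w ^+ 2 + (2 * (S n w * W n.+1 w) + W n.+1 w ^+ 2)].
  by apply: eq_Rintegral => w _; rewrite SS; ring.
have i2SW : itg (fun w => 2 * (S n w * W n.+1 w)).
  exact: (integrableZl measurableT 2 iSW).
rewrite expectD//; last exact: (integrableD measurableT i2SW (iW n.+1)).
rewrite expectD// expectZ// SW// mulr0 add0r -natr1 mulrDl mul1r.
by rewrite lerD// WC.
Qed.

(** At time (k+1)^2 the squared average has mean at most C / (k+1)^2. These means are summable, so
    the series of squared averages is almost surely finite and its terms vanish. The remaining times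
    are reached by interpolation, for which a lower bound on [W] is enough; centred run lengths may
    be unbounded above. *)
Lemma slln_orthogonal (B : R) : (forall k w, - B <= W k w) ->
  {ae P, forall w, avg (fun k => W k w) @ \oo --> (0 : R)}.
Proof.
move=> WB.
pose a (k : nat) w : R := avg (fun j => W j w) (k.+1 ^ 2)%N ^+ 2.
have aE k w : a k w = ((k.+1 ^ 2)%:R ^+ 2)^-1 * S (k.+1 ^ 2)%N w ^+ 2.
  by rewrite /a /avg exprMn exprVn.
have a0 k w : 0 <= a k w by rewrite /a sqr_ge0.
have ma k : measurable_fun setT (a k).
  have -> : a k = (fun w => ((k.+1 ^ 2)%:R ^+ 2)^-1 * S (k.+1 ^ 2)%N w ^+ 2).
    by apply/funext => w; exact: aE.
  by apply: measurable_funM => //; exact: measurable_funX.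
have C0 : 0 <= C.
  by rewrite (le_trans _ (WC 0))// Rintegral_ge0// => w _; exact: sqr_ge0.
have Ea k : (\int[P]_w (a k w)%:E <= (C * (k.+1%:R ^+ 2)^-1)%:E)%E.
  have i1 := iS (k.+1 ^ 2).
  have -> : (\int[P]_w (a k w)%:E)%E = ('E[a k])%:E.
    rewrite /Rintegral fineK// integrable_fin_num//.
    have := integrableZl measurableT (((k.+1 ^ 2)%:R ^+ 2)^-1) i1.
    by apply: eq_integrable => // w _; rewrite /= aE.
  rewrite lee_fin.
  under eq_Rintegral do rewrite aE.
  rewrite expectZ; last exact: i1.
  have c0 : 0 <= ((k.+1 ^ 2)%:R ^+ 2 : R)^-1 by rewrite invr_ge0 sqr_ge0.
  rewrite (le_trans (ler_wpM2l c0 (expect_sum_sqr _)))//.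
  rewrite natrX; set x : R := k.+1%:R.
  have x0 : x != 0 by rewrite pnatr_eq0.
  suff -> : (x ^+ 2 ^+ 2)^-1 * (x ^+ 2 * C) = C * (x ^+ 2)^-1 by [].
  by field.
have sumlt : (\int[P]_w (\sum_(0 <= k <oo) (a k w)%:E) < +oo)%E.
  rewrite integral_nneseries//; last 2 first.
  - by move=> k; exact/measurable_EFinP.
  - by move=> k w _; rewrite lee_fin.
  apply: (@le_lt_trans _ _ (C * 2)%:E); last exact: ltry.
  apply: lime_le.
    by apply: is_cvg_nneseries => k _ _; apply: integral_ge0 => w _; rewrite lee_fin.
  near=> n; have n0 : (0 < n)%N by near: n; exact: nbhs_infty_gt.
  rewrite (@le_trans _ _ (\sum_(0 <= k < n) (C * (k.+1%:R ^+ 2)^-1)%:E)%E)//.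
    by apply: lee_sum => k _; exact: Ea.
  rewrite sumEFin lee_fin -mulr_sumr ler_wpM2l//.
  rewrite -(prednK n0) (le_trans (sum_inv_sqr _))// lerBlDr lerDl.
  by rewrite invr_ge0.
have isum : P.-integrable setT (fun w => \sum_(0 <= k <oo) (a k w)%:E)%E.
  apply/integrableP; split.
    apply: ge0_emeasurable_sum => //; last by move=> k _; exact/measurable_EFinP.
    by move=> k w _ _; rewrite lee_fin.
  rewrite (eq_integral (fun w => \sum_(0 <= k <oo) (a k w)%:E)%E)// => w _.
  by rewrite gee0_abs//; apply: nneseries_ge0 => k _ _; rewrite lee_fin.
have := integrable_ae measurableT isum.
apply: filterS => w /(_ Logic.I) finw.
have bnd n : \sum_(0 <= k < n) a k w <= fine (\sum_(0 <= k <oo) (a k w)%:E)%E.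
  rewrite -lee_fin fineK// -sumEFin; apply: nneseries_lim_ge => k _ _.
  by rewrite lee_fin.
have cva : (a ^~ w) @ \oo --> (0 : R).
  apply: cvg_series_cvg_0; apply: nondecreasing_is_cvgn.
    by apply/nondecreasing_seqP => n; rewrite /series/= big_nat_recr//= lerDl.
  by exists (fine (\sum_(0 <= k <oo) (a k w)%:E)%E) => _ [n _ <-]; exact: bnd.
apply: (@cvg_avg_squares _ _ B) => //.
have : (fun k => Num.sqrt (a k w)) @ \oo --> (0 : R).
  rewrite -[X in _ --> X](@sqrtr0 R).
  exact: (continuous_cvg _ (@sqrt_continuous R 0) cva).
by apply: cvg0_le_norm => k; rewrite /a sqrtr_sqr.
Unshelve. all: by end_near. Qed.

End orthogonal.
End slln.

(** * Independent identically distributed variables *)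

Section iid.
Context {R : realType} {d : measure_display} {T : measurableType d}.
Variable P : probability T R.

(** The product rule on rectangles identifies the joint law with the product of the marginal laws;
    Tonelli does the rest. *)
Lemma ge0_expect_mul_indep (f g : T -> \bar R) :
  measurable_fun setT f -> measurable_fun setT g ->
  (forall w, 0 <= f w)%E -> (forall w, 0 <= g w)%E ->
  (forall A B, measurable A -> measurable B ->
    P (f @^-1` A `&` g @^-1` B) = P (f @^-1` A) * P (g @^-1` B))%E ->
  (\int[P]_w (f w * g w) = \int[P]_w f w * \int[P]_w g w)%E.
Proof.
move=> mf mg f0 g0 fg.
pose f' : {mfun T >-> \bar R} := HB.pack f (isMeasurableFun.Build _ _ _ _ _ mf).
pose g' : {mfun T >-> \bar R} := HB.pack g (isMeasurableFun.Build _ _ _ _ _ mg).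
have mh : measurable_fun setT (fun w => (f w, g w)) by exact: measurable_fun_pair.
pose h : {mfun T >-> (\bar R * \bar R)%type} :=
  HB.pack (fun w => (f w, g w)) (isMeasurableFun.Build _ _ _ _ _ mh).
pose D1 := distribution P f'; pose D2 := distribution P g'.
pose D := distribution P h.
have DE X : measurable X -> (D1 \x D2)%E X = D X.
  by apply: product_measure_unique => A B mA mB; exact: fg.
(* Absolute values make the integrand nonnegative on the whole plane, not just on the range of
   [(f, g)]. *)
pose u (z : \bar R * \bar R) := (`|z.1| * `|z.2|)%E.
have u0 z : (0 <= u z)%E by rewrite mule_ge0.
have mu : measurable_fun setT u.
  by apply: emeasurable_funM; exact: measurableT_comp.
transitivity (\int[D]_z u z)%E.
  rewrite /D ge0_integral_pushforward//.
  by apply: eq_integral => w _; rewrite /u /= !gee0_abs.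
rewrite (eq_measure_integral (D1 \x D2)%E); last by move=> A mA _; apply: esym; exact: DE.
rewrite fubini_tonelli1// /fubini_F /u /=.
have D2E : (\int[D2]_y `|y| = \int[P]_w g w)%E.
  rewrite /D2 ge0_integral_pushforward//.
  by apply: eq_integral => w _; rewrite /= gee0_abs.
have D1E : (\int[D1]_y `|y| = \int[P]_w f w)%E.
  rewrite /D1 ge0_integral_pushforward//.
  by apply: eq_integral => w _; rewrite /= gee0_abs.
under eq_integral do rewrite ge0_integralZl// D2E.
by rewrite ge0_integralZr// ?D1E// integral_ge0.
Qed.

Lemma measurable_expeR : measurable_fun setT (@expeR R).
Proof.
have m1 (a : \bar R) : measurable_fun setT (fun x : \bar R => x == a).
  apply: (measurable_fun_bool true); rewrite setTI.
  rewrite (_ : _ @^-1` _ = [set a]); first exact: emeasurable_set1.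
  by apply/seteqP; split => x /=; [move/eqP|move=> ->; rewrite eqxx].
have -> : @expeR R = (fun x => if x == +oo then +oo else
    if x == -oo then 0 else (expR (fine x))%:E)%E.
  by apply/funext => -[].
apply: measurable_fun_ifT => //; apply: measurable_fun_ifT => //.
by apply/measurable_EFinP; apply: measurableT_comp => //; exact: fine_measurable.
Qed.

(* [fine] sends infinite values to 0, so [absf] is only faithful where x is finite. *)
Definition absf (x : \bar R) : R := `|fine x|.

Lemma absf_ge0 x : 0 <= absf x. Proof. exact: normr_ge0. Qed.

Lemma measurable_absf : measurable_fun setT absf.
Proof. by apply: measurableT_comp => //; exact: fine_measurable. Qed.

(** With y = t |x|, the bound 1 + y^2 / 2 <= exp y and exp (t |x|) <= exp (t x) + exp (- t x):
    two-sided exponential moments control the second moment. At infinite [x] the left side is 0. *)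
Lemma absf_sqr_le (t : R) x : 0 < t ->
  ((absf x ^+ 2)%:E <=
   (2 / t ^+ 2)%:E * (expeR (t%:E * x) + expeR ((- t)%:E * x)))%E.
Proof.
move=> t0; have t2 : 0 <= 2 / t ^+ 2 by rewrite divr_ge0// sqr_ge0.
have nonfin : absf x = 0 -> ((absf x ^+ 2)%:E <=
   (2 / t ^+ 2)%:E * (expeR (t%:E * x) + expeR ((- t)%:E * x)))%E.
  by move=> ->; rewrite expr0n mule_ge0// adde_ge0// expeR_ge0.
case: x nonfin => [r _|->//|->//]; rewrite /absf ?normr0//=.
rewrite lee_fin mulrAC ler_pdivlMr ?exprn_gt0// mulNr.
have e0 := expR_ge0 (t * r); have e1 := expR_ge0 (- (t * r)).
have {}h : 1 + (t * `|r|) ^+ 2 / 2 <= expR (t * `|r|).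
  by apply: (@expR_ge1Dxn _ _ 1); rewrite mulr_ge0// ltW.
rewrite -exprMn mulrC.
have : expR (t * `|r|) <= expR (t * r) + expR (- (t * r)).
  have [r0|r0] := leP 0 r; first by rewrite ger0_norm// lerDl.
  by rewrite ltr0_norm// mulrN lerDr.
lra.
Qed.

Lemma iid_measurable (Z : nat -> T -> \bar R) (K : set nat) k :
  iid P K Z -> K k -> measurable_fun setT (Z k).
Proof.
by move=> [[+ _] _] Kk => /(_ k Kk) ZK _ B mB; apply: ZK; exists B.
Qed.

Lemma mutual_independence2 {d' : measure_display} {U : measurableType d'}
    (Z : nat -> T -> U) (K : set nat) i j A B :
  mutual_independence P K (fun k => sigma_rv (Z k)) -> K i -> K j -> i != j ->
  measurable A -> measurable B ->
  (P (Z i @^-1` A `&` Z j @^-1` B) = P (Z i @^-1` A) * P (Z j @^-1` B))%E.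
Proof.
move=> [_ ind] Ki Kj ij mA mB.
pose E k := if k == i then Z i @^-1` A else Z j @^-1` B.
have Ei : E i = Z i @^-1` A by rewrite /E eqxx.
have Ej : E j = Z j @^-1` B by rewrite /E eq_sym (negbTE ij).
have := ind [fset i; j]%fset E.
rewrite big_fsetU1 ?inE//= big_seq_fset1 -Ei -Ej => <-.
- by congr (P _); rewrite bigcap_fset big_fsetU1 ?inE//= big_seq_fset1.
- by move=> k /=; rewrite !inE => /orP[] /eqP ->.
- move=> k; rewrite !inE => /orP[] /eqP ->.
    by rewrite Ei; exists A => //; rewrite setTI.
  by rewrite Ej; exists B => //; rewrite setTI.
Qed.

Section slln_iid.
Variable Z : nat -> T -> \bar R.
Let K := [set k | (1 <= k)%N].
Hypothesis iidZ : iid P K Z.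
Hypothesis expZ : exp_moments P (Z 1%N).

Let mZ k : (0 < k)%N -> measurable_fun setT (Z k).
Proof. exact: (iid_measurable iidZ). Qed.

Let maZ k : (0 < k)%N -> measurable_fun setT (absf \o Z k).
Proof. by move=> k0; apply: measurableT_comp (mZ k0); exact: measurable_absf. Qed.

Lemma iid_integral (f : \bar R -> \bar R) k : (0 < k)%N ->
  measurable_fun setT f -> (forall x, 0 <= f x)%E ->
  (\int[P]_w f (Z k w) = \int[P]_w f (Z 1%N w))%E.
Proof.
move=> k0 mf f0; have [_ id] := iidZ.
pose Zk : {mfun T >-> \bar R} :=
  HB.pack (Z k) (isMeasurableFun.Build _ _ _ _ _ (mZ k0)).
pose Z1 : {mfun T >-> \bar R} :=
  HB.pack (Z 1%N) (isMeasurableFun.Build _ _ _ _ _ (mZ (ltn0Sn 0))).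
transitivity (\int[distribution P Zk]_x f x)%E.
  by rewrite ge0_integral_pushforward.
rewrite (eq_measure_integral (distribution P Z1)); last first.
  by move=> A mA _; exact: id.
by rewrite ge0_integral_pushforward.
Qed.

Let int2 : (\int[P]_w (absf (Z 1 w) ^+ 2)%:E < +oo)%E.
Proof.
have [dl dl0 h] := expZ.
pose t := dl / 2; have t0 : 0 < t by rewrite divr_gt0.
have mE (s : R) : measurable_fun setT (fun w => expeR (s%:E * Z 1%N w)%E).
  apply: measurableT_comp; first exact: measurable_expeR.
  by apply: emeasurable_funM => //; exact: mZ.
have h1 : (\int[P]_w expeR (t%:E * Z 1%N w) < +oo)%E by apply: h; rewrite /t; lra.
have h2 : (\int[P]_w expeR ((- t)%:E * Z 1%N w) < +oo)%E by apply: h; rewrite /t; lra.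
apply: (@le_lt_trans _ _ (\int[P]_w ((2 / t ^+ 2)%:E *
   (expeR (t%:E * Z 1%N w) + expeR ((- t)%:E * Z 1%N w))))%E).
  apply: ge0_le_integral => //.
  - by move=> w _; rewrite lee_fin sqr_ge0.
  - by apply/measurable_EFinP; apply: measurable_funX; exact: maZ.
  - by apply: emeasurable_funM => //; exact: emeasurable_funD.
  - by move=> w _; exact: absf_sqr_le.
have c0 : 0 <= 2 / t ^+ 2 by rewrite divr_ge0// sqr_ge0.
rewrite ge0_integralZl_EFin//; last 2 first.
  - by move=> w _; rewrite adde_ge0// expeR_ge0.
  - exact: emeasurable_funD.
rewrite ge0_integralD//; last 2 first.
  - by move=> w _; rewrite expeR_ge0.
  - by move=> w _; rewrite expeR_ge0.
by rewrite lte_mul_pinfty// lte_add_pinfty.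
Qed.

(** [expeR] is infinite at [+oo], so a finite exponential moment at some t > 0 excludes that value.
    Applied to run lengths, it says that almost surely no run is infinite. *)
Lemma iid_lt_pinfty : {ae P, forall w, forall k, (0 < k)%N -> (Z k w < +oo)%E}.
Proof.
have [dl dl0 h] := expZ.
pose t := dl / 2; have t0 : 0 < t by rewrite divr_gt0.
have h1 : (\int[P]_w expeR (t%:E * Z 1%N w) < +oo)%E by apply: h; rewrite /t; lra.
have mE : measurable_fun setT (fun x : \bar R => expeR (t%:E * x)%E).
  apply: measurableT_comp; first exact: measurable_expeR.
  by apply: emeasurable_funM.
apply: ae_foralln => -[|k]; first exact: aeW.
have ik : P.-integrable setT (fun w => expeR (t%:E * Z k.+1 w)%E).
  apply/integrableP; split; first exact: measurableT_comp mE (mZ _).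
  rewrite (eq_integral (fun w => expeR (t%:E * Z k.+1 w)%E)); last first.
    by move=> w _; rewrite gee0_abs// expeR_ge0.
  by rewrite (@iid_integral (fun x => expeR (t%:E * x)%E))// => x; exact: expeR_ge0.
have := integrable_ae measurableT ik.
apply: filterS => w /(_ Logic.I) + _; rewrite ltey; apply: contraTneq => ->.
by rewrite gt0_muley ?lte_fin.
Qed.

(** Nothing is assumed of [Z 0], whereas [slln_orthogonal] speaks of all indices; index 0 borrows
    [Z 1]. *)
Let kk k := if k is 0 then 1%N else k.
Let kk0 k : (0 < kk k)%N. Proof. by case: k. Qed.

(** Pairwise independence makes the variables orthogonal once centred at their mean a; nonnegativity
    of [absf] gives the lower bound -a. *)
Lemma slln_iid : exists a : R,
  {ae P, forall w, avg (fun k => absf (Z k w)) @ \oo --> a}.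
Proof.
pose f k w := absf (Z (kk k) w).
have mf k : measurable_fun setT (f k) by exact: maZ.
have if2 k : P.-integrable setT (EFin \o (fun w => f k w ^+ 2)).
  apply/integrableP; split.
    by apply/measurable_EFinP; exact: measurable_funX.
  rewrite (eq_integral (fun w => (absf (Z (kk k) w) ^+ 2)%:E)); last first.
    by move=> w _ /=; rewrite ger0_norm// sqr_ge0.
  rewrite (@iid_integral (fun x => (absf x ^+ 2)%:E))//.
  - by apply/measurable_EFinP/measurable_funX; exact: measurable_absf.
  - by move=> x; rewrite lee_fin sqr_ge0.
have if1 k : P.-integrable setT (EFin \o f k).
  have i1 : P.-integrable setT (EFin \o (fun=> 1 ^+ 2) : T -> \bar R).
    exact: finite_measure_integrable_cst.
  have := itg_mul (mf k) (measurable_cst _) (if2 k) i1.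
  by apply: eq_integrable => // w _; rewrite /= mulr1.
pose a : R := \int[P]_w f 1%N w.
have Ef k : \int[P]_w f k w = a.
  congr fine; apply: (@iid_integral (EFin \o absf)) => //.
    by apply/measurable_EFinP; exact: measurable_absf.
  by move=> x; rewrite lee_fin absf_ge0.
pose c : R := \int[P]_w (f 1%N w ^+ 2).
have Ef2 n : \int[P]_w (f n w ^+ 2) = c.
  congr fine; apply: (@iid_integral (fun x => (absf x ^+ 2)%:E)) => //.
  - by apply/measurable_EFinP/measurable_funX; exact: measurable_absf.
  - by move=> x; rewrite lee_fin sqr_ge0.
have Eff i j : (0 < i < j)%N -> \int[P]_w (f i w * f j w) = a ^+ 2.
  move=> /andP[i0 ij]; have j0 := ltn_trans i0 ij.
  rewrite expr2 -{1}(Ef i) -(Ef j) /Rintegral -fineM; last 2 first.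
  - exact: (integrable_fin_num measurableT (if1 i)).
  - exact: (integrable_fin_num measurableT (if1 j)).
  congr fine; under eq_integral do rewrite EFinM.
  apply: (@ge0_expect_mul_indep (EFin \o f i) (EFin \o f j)).
  - exact/measurable_EFinP.
  - exact/measurable_EFinP.
  - by move=> w; rewrite lee_fin absf_ge0.
  - by move=> w; rewrite lee_fin absf_ge0.
  move=> A B mA mB.
  have mS C : measurable C -> measurable ((EFin \o absf) @^-1` C).
    have : measurable_fun setT (EFin \o absf).
      by apply/measurable_EFinP; exact: measurable_absf.
    by move=> m mC; rewrite -[X in measurable X]setTI; exact: m.
  have kkE k : (0 < k)%N -> kk k = k by case: k.
  rewrite /f !kkE//.
  apply: (mutual_independence2 (proj1 iidZ) i0 j0 _ (mS _ mA) (mS _ mB)).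
  by rewrite ltn_eqF.
exists a; pose W k w := f k w - a.
have icst (b : R) : P.-integrable setT (EFin \o (fun=> b) : T -> \bar R).
  exact: finite_measure_integrable_cst.
have mW k : measurable_fun setT (W k) by exact: measurable_funB.
have WE2 k w : W k w ^+ 2 = f k w ^+ 2 + ((- (2 * a)) * f k w + a ^+ 2).
  by rewrite /W; ring.
have i3 k : P.-integrable setT (EFin \o (fun w => - (2 * a) * f k w)).
  exact: (integrableZl measurableT (- (2 * a)) (if1 k)).
have i4 k : P.-integrable setT (EFin \o (fun w => - (2 * a) * f k w + a ^+ 2)).
  exact: (integrableD measurableT (i3 k) (icst _)).
have Ecst (b : R) : \int[P]_w (fun=> b) w = b.
  rewrite Rintegral_cst// -[RHS]mulr1; congr (b * _).
  have h := @probability_setT _ _ _ P; exact: (f_equal (@fine R) h).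
have iW k : P.-integrable setT (EFin \o (fun w => W k w ^+ 2)).
  have := integrableD measurableT (if2 k) (i4 k).
  by apply: eq_integrable => // w _ /=; rewrite -EFinD WE2.
have WC k : \int[P]_w (fun w => W k w ^+ 2) w <= c - a ^+ 2.
  under eq_Rintegral do rewrite WE2.
  rewrite expectD// expectD// expectZ// Ef2 Ef.
  rewrite Ecst; lra.
have WW i j : (0 < i < j)%N -> \int[P]_w (fun w => W i w * W j w) w = 0.
  move=> ij.
  have -> : \int[P]_w (fun w => W i w * W j w) w = \int[P]_w
      (f i w * f j w + ((- a) * f i w + ((- a) * f j w + a ^+ 2))).
    by apply: eq_Rintegral => w _; rewrite /W; ring.
  have j1 k : P.-integrable setT (EFin \o (fun w => (- a) * f k w)).
    exact: (integrableZl measurableT (- a) (if1 k)).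
  have j2 : P.-integrable setT (EFin \o (fun w => (- a) * f j w + a ^+ 2)).
    exact: (integrableD measurableT (j1 j) (icst _)).
  have j3 : P.-integrable setT
      (EFin \o (fun w => (- a) * f i w + ((- a) * f j w + a ^+ 2))).
    exact: (integrableD measurableT (j1 i) j2).
  have j4 := itg_mul (mf i) (mf j) (if2 i) (if2 j).
  rewrite expectD// expectD// expectD// !expectZ// Eff// !Ef Ecst; ring.
have Wa k w : - a <= W k w by rewrite /W lerBrDl subrr absf_ge0.
have := slln_orthogonal mW iW WC WW Wa.
apply: filterS => w Ww.
rewrite -[X in _ --> X](add0r a).
have : (fun n => avg (fun k => W k w) n + a) @ \oo --> 0 + a.
  by apply: cvgD => //; exact: cvg_cst.
apply: cvg_trans; apply: near_eq_cvg; near=> n => /=.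
have n0 : (0 < n)%N by near: n; exact: nbhs_infty_gt.
rewrite -[in LHS](avg_cst a n0) -avgD.
by apply: eq_avg => -[//|k] _; rewrite /W /f /= subrK.
Unshelve. all: by end_near. Qed.

End slln_iid.
End iid.

(** * Runs of a trajectory *)

Section runs_of_a_path.
Context {R : realType}.
Variable l : nat -> bool.

Definition hitting_times (m : nat) (b : bool) : set (\bar R) :=
  [set n%:R%:E | n in [set n : nat | (m%:R%:E < n%:R%:E :> \bar R)%E /\ l n.+1 = b]].

(** A finite infimum of integers is attained. The times n > m look at [l n.+1], so position [m.+1]
    is never inspected: it opens the current run, and its value has to be known beforehand. *)
Lemma ereal_inf_hitting (m : nat) (b : bool) :
  (ereal_inf (hitting_times m b) < +oo)%E ->
  exists n, [/\ (m < n)%N, l n.+1 = b, forall j, (m.+1 < j <= n)%N -> l j = ~~ b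
    & ereal_inf (hitting_times m b) = n%:R%:E].
Proof.
rewrite /hitting_times.
set S : set nat := [set n | _] => infS.
have SE n : S n <-> (m < n)%N /\ l n.+1 = b by rewrite /S/= lte_fin ltr_nat.
have exS : exists n, (m < n)%N && (l n.+1 == b).
  have [n Sn] : S !=set0.
    apply/set0P/eqP => S0; move: infS.
    by rewrite S0 image_set0 ereal_inf0 ltxx.
  by exists n; have /SE[-> ->] := Sn; rewrite eqxx.
case: (ex_minnP exS) => n /andP[mn /eqP ln] nmin; exists n; split=> //.
  move=> [//|j]; rewrite !ltnS => /andP[mj jn].
  have [lj|] := eqVneq (l j.+1) b; last by case: (l j.+1); case: (b).
  by have := nmin j; rewrite mj lj eqxx leqNgt jn => /(_ isT).
apply/eqP; rewrite eq_le; apply/andP; split.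
  by apply: ereal_inf_lbound; exists n => //; apply/SE.
apply: le_ereal_inf_tmp => _ [j /SE[mj lj] <-]; rewrite lee_fin ler_nat.
by apply: nmin; rewrite mj lj eqxx.
Qed.

Lemma next_tau_nat (m : nat) : l m.+1 ->
  (next_tau l (m%:R%:E : \bar R) < +oo)%E ->
  exists t, [/\ (0 < t)%N, next_tau l m%:R%:E = t%:R%:E :> \bar R,
    forall j, (m < j <= m + t)%N -> l j & l (m + t).+1 = false].
Proof.
move=> lm; rewrite /next_tau ltry => infS.
have [|n [mn ln lj infE]] := @ereal_inf_hitting m false.
  by move: infS; rewrite lteBlDr// addye.
exists (n - m)%N; split; first by rewrite subn_gt0.
- by rewrite infE -EFinB natrB// ltnW.
- move=> j /andP[mj]; rewrite subnKC ?(ltnW mn)// => jn.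
  have [->//|jm] := eqVneq j m.+1.
  by rewrite lj//; lia.
- by rewrite subnKC// ltnW.
Qed.

Lemma next_sigma_nat (m t : nat) : l (m + t).+1 = false ->
  next_tau l m%:R%:E = t%:R%:E :> \bar R ->
  (next_sigma l (m%:R%:E : \bar R) < +oo)%E ->
  exists s, [/\ (0 < s)%N, next_sigma l m%:R%:E = s%:R%:E :> \bar R,
    forall j, (m + t < j <= m + t + s)%N -> l j = false & l (m + t + s).+1].
Proof.
move=> lmt tE; rewrite /next_sigma tE !ltry /= -EFinD -natrD => infS.
have [|n [mn ln lj infE]] := @ereal_inf_hitting (m + t) true.
  by move: infS; rewrite /hitting_times; case: (ereal_inf _) => [r||]// _; rewrite ltry.
exists (n - (m + t))%N; split; first by rewrite subn_gt0.
- rewrite infE -!EFinB natrB; last exact: ltnW.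
  by rewrite natrD opprD addrA.
- move=> j /andP[mj]; rewrite subnKC ?(ltnW mn)// => jn.
  have [->//|jm] := eqVneq j (m + t).+1.
  by rewrite lj//; lia.
- by rewrite subnKC// ltnW.
Qed.

Hypothesis l1 : l 1%N.
Hypothesis tau_fin : forall k, (0 < k)%N -> (@run_tau R l k < +oo)%E.
Hypothesis sigma_fin : forall k, (0 < k)%N -> (@run_sigma R l k < +oo)%E.

Lemma run_mu_nat k : exists m : nat,
  run_mu l k = m%:R%:E :> \bar R /\ l m.+1.
Proof.
elim: k => [|k [m [mE lm]]]; first by exists 0%N.
have tf := tau_fin (ltn0Sn k); have sf := sigma_fin (ltn0Sn k).
rewrite /run_tau/= mE in tf; rewrite /run_sigma/= mE in sf.
have [t [t0 tE lt lmt]] := next_tau_nat lm tf.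
have [s [s0 sE ls lms]] := next_sigma_nat lmt tE sf.
exists (m + t + s)%N; split=> //=.
by rewrite mE tE sE -!EFinD !natrD.
Qed.

(** Natural-number form of the runs, with an index shift: [t k] and [s k] belong to cycle [k.+1],
    which fills the positions from [(m k).+1] to [m k.+1]. *)
Lemma run_lengths : exists m t s : nat -> nat, forall k,
  [/\ (m 0 = 0)%N, m k.+1 = (m k + t k + s k)%N,
      [/\ (0 < t k)%N, (0 < s k)%N, run_tau l k.+1 = (t k)%:R%:E :> \bar R
        & run_sigma l k.+1 = (s k)%:R%:E :> \bar R],
      forall j, (m k < j <= m k + t k)%N -> l j
    & forall j, (m k + t k < j <= m k + t k + s k)%N -> l j = false].
Proof.
have /choice[m mP] := run_mu_nat.
have H k : exists ts : nat * nat,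
  [/\ m k.+1 = (m k + ts.1 + ts.2)%N,
      [/\ (0 < ts.1)%N, (0 < ts.2)%N, run_tau l k.+1 = (ts.1)%:R%:E :> \bar R
        & run_sigma l k.+1 = (ts.2)%:R%:E :> \bar R],
      forall j, (m k < j <= m k + ts.1)%N -> l j
    & forall j, (m k + ts.1 < j <= m k + ts.1 + ts.2)%N -> l j = false].
  have [mE lm] := mP k; have [mE' _] := mP k.+1.
  have tf := tau_fin (ltn0Sn k); have sf := sigma_fin (ltn0Sn k).
  rewrite /run_tau/= mE in tf; rewrite /run_sigma/= mE in sf.
  have [t [t0 tE lt lmt]] := next_tau_nat lm tf.
  have [s [s0 sE ls lms]] := next_sigma_nat lmt tE sf.
  exists (t, s); split=> //=; last by rewrite /run_tau /run_sigma /= mE.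
  move: mE'; rewrite /= mE tE sE -!EFinD -!natrD => -[/eqP].
  by rewrite eqr_nat => /eqP.
have /choice[ts tsP] := H.
exists m, (fun k => (ts k).1), (fun k => (ts k).2) => k.
have [h1 h2 h3 h4] := tsP k; split=> //.
by have [[/eqP]] := mP 0%N; rewrite eq_sym /= (eqr_nat R _ 0) => /eqP.
Qed.

(** Up to time [m k] there are exactly [Tk k] ones. For n between [m k] and [m k.+1] the density of
    ones thus lies between [Tk k / m k.+1] and [Tk k.+1 / m k], and both tend to a / (a + b). All
    runs have length at least one, hence a and b are at least 1. *)
Lemma cvg_run_density (a b : R) :
  avg (fun k => absf (run_tau l k)) @ \oo --> a ->
  avg (fun k => absf (run_sigma l k)) @ \oo --> b ->
  [/\ 1 <= a, 1 <= b & avg (fun j => (l j)%:R) @ \oo --> a / (a + b)].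
Proof.
move=> ta sb; have [m [t [s mts]]] := run_lengths.
pose Tk k := (\sum_(0 <= i < k) t i)%N.
pose c n := (\sum_(1 <= j < n.+1) l j)%N.
have tauE k : (0 < k)%N -> absf (run_tau l k : \bar R) = (t k.-1)%:R.
  by case: k => // k _; have [_ _ [_ _ -> _] _ _] := mts k; rewrite /absf/= normr_nat.
have sigE k : (0 < k)%N -> absf (run_sigma l k : \bar R) = (s k.-1)%:R.
  by case: k => // k _; have [_ _ [_ _ _ ->] _ _] := mts k; rewrite /absf/= normr_nat.
have t0 k : (0 < t k)%N by have [_ _ []] := mts k.
have s0 k : (0 < s k)%N by have [_ _ []] := mts k.
have avgt k : k%:R * avg (fun k => absf (run_tau l k : \bar R)) k = (Tk k)%:R.
  by rewrite (eq_avg _ tauE) natr_avg big_add1 /Tk natr_sum.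
have avgm k : k%:R * (avg (fun k => absf (run_tau l k : \bar R)) k
     + avg (fun k => absf (run_sigma l k : \bar R)) k) = (m k)%:R.
  rewrite (eq_avg _ tauE) (eq_avg _ sigE) mulrDr !natr_avg !big_add1.
  elim: k => [|k ih]; first by rewrite !big_geq// addr0; have [-> _ _ _ _] := mts 0%N.
  have [_ -> _ _ _] := mts k.
  by rewrite !(big_nat_recr k)//= !natrD -ih; ring.
have avg_ge1 (u : nat -> \bar R) (v : nat -> nat) (x : R) :
    (forall k, (0 < k)%N -> absf (u k) = (v k.-1)%:R) -> (forall k, (0 < v k)%N) ->
    avg (fun k => absf (u k)) @ \oo --> x -> 1 <= x.
  move=> uE v0 ux; apply: (cvgr_to_ge ux); near=> n.
  have n0 : (0 < n)%N by near: n; exact: nbhs_infty_gt.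
  rewrite (eq_avg _ uE) -[leLHS](avg_cst 1 n0) /avg ler_wpM2l ?invr_ge0//.
  by apply: ler_sum => i _; rewrite ler1n.
have a1 : 1 <= a := avg_ge1 _ _ _ tauE t0 ta.
have b1 : 1 <= b := avg_ge1 _ _ _ sigE s0 sb.
split=> //.
have m0 : m 0 = 0%N by have [-> _ _ _ _] := mts 0%N.
have mS k : m k.+1 = (m k + t k + s k)%N by have [_ -> _ _ _] := mts k.
have m_ge k : (k <= m k)%N.
  by elim: k => // k ih; rewrite mS; have := t0 k; lia.
have m_lt i j : (i < j)%N -> (m i < m j)%N.
  elim: j => // j ih; rewrite ltnS leq_eqVlt => /orP[/eqP->|/ih h].
    by rewrite mS; have := t0 j; lia.
  by rewrite mS; have := t0 j; lia.
have cS i j : (i <= j)%N -> (c i <= c j)%N.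
  by move=> ij; rewrite /c [leqRHS](big_cat_nat (n := i.+1))//= leq_addr.
have cm k : c (m k) = Tk k.
  elim: k => [|k ih]; first by rewrite m0 /c /Tk !big_geq.
  have [_ _ _ lt ls] := mts k.
  rewrite /c (big_cat_nat (n := (m k).+1))//=; last by rewrite mS; lia.
  rewrite [X in (X + _)%N]ih /Tk [RHS]big_nat_recr//=; congr addn.
  rewrite (big_cat_nat (n := (m k + t k).+1))//=; [|lia|rewrite mS; lia].
  rewrite [X in (_ + X)%N]big_nat_cond [X in (_ + X)%N]big1 ?addn0; last first.
    by move=> i /andP[/andP[i1 i2] _]; rewrite ls//; rewrite mS in i2; lia.
  rewrite big_nat_cond (eq_bigr (fun=> 1%N)); last first.
    by move=> i /andP[/andP[i1 i2] _]; rewrite lt//; lia.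
  by rewrite -big_nat_cond sum_nat_const_nat; lia.
have ab0 : 0 < a + b by lra.
pose tt k : R := (Tk k)%:R / k%:R; pose mm k : R := (m k)%:R / k%:R.
have ttE k : (0 < k)%N -> tt k = avg (fun k => absf (run_tau l k : \bar R)) k.
  by move=> k0; rewrite /tt -avgt mulrAC divff ?mul1r// pnatr_eq0 -lt0n.
have mmE k : (0 < k)%N -> mm k = avg (fun k => absf (run_tau l k : \bar R)) k +
    avg (fun k => absf (run_sigma l k : \bar R)) k.
  by move=> k0; rewrite /mm -avgm mulrAC divff ?mul1r// pnatr_eq0 -lt0n.
have ctt : tt @ \oo --> a.
  apply: cvg_trans ta; apply: near_eq_cvg; near=> n; rewrite -ttE//.
  by near: n; exact: nbhs_infty_gt.
have cmm : mm @ \oo --> a + b.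
  apply: cvg_trans (cvgD ta sb); apply: near_eq_cvg; near=> n; rewrite mmE//.
  by near: n; exact: nbhs_infty_gt.
(* Both bounds pair [Tk] and [m] at neighbouring indices; once these are divided by their own index,
   this factor remains. *)
have ratio : (fun k : nat => k.+1%:R / k%:R : R) @ \oo --> (1 : R).
  rewrite -[X in _ --> X](@addr0 R).
  have : (fun k : nat => 1 + (k%:R)^-1 : R) @ \oo --> 1 + (0 : R).
    apply: cvgD; first exact: cvg_cst.
    by rewrite -cvg_shiftS; exact: cvg_harmonic.
  apply: cvg_trans; apply: near_eq_cvg; near=> n.
  rewrite -natr1 mulrDl mul1r divff// pnatr_eq0 -lt0n.
  by near: n; exact: nbhs_infty_gt.
have abn : a + b != 0 by rewrite gt_eqF.
have lo : (fun k => (Tk k)%:R / (m k.+1)%:R : R) @ \oo --> a / (a + b).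
  have : (fun k => tt k / (mm k.+1 * (k.+1%:R / k%:R))) @ \oo --> a / ((a + b) * 1).
    apply: cvgM => //; apply: cvgV; first by rewrite mulr1.
    by apply: cvgM => //; rewrite (cvg_shiftS mm).
  rewrite mulr1; apply: cvg_trans; apply: near_eq_cvg; near=> n.
  have n0 : (n%:R : R) != 0.
    by rewrite pnatr_eq0 -lt0n; near: n; exact: nbhs_infty_gt.
  have mn0 : ((m n.+1)%:R : R) != 0.
    by rewrite pnatr_eq0 -lt0n (leq_trans _ (m_ge _)).
  rewrite /tt /mm; field.
  by rewrite n0 mn0 nat1r pnatr_eq0.
have up : (fun k => (Tk k.+1)%:R / (m k)%:R : R) @ \oo --> a / (a + b).
  have : (fun k => tt k.+1 * (k.+1%:R / k%:R) / mm k) @ \oo --> a * 1 / (a + b).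
    apply: cvgM; last exact: cvgV.
    by apply: cvgM => //; rewrite (cvg_shiftS tt).
  rewrite mulr1; apply: cvg_trans; apply: near_eq_cvg; near=> n.
  have n1 : (0 < n)%N by near: n; exact: nbhs_infty_gt.
  have n0 : (n%:R : R) != 0 by rewrite pnatr_eq0 -lt0n.
  have mn0 : ((m n)%:R : R) != 0.
    by rewrite pnatr_eq0 -lt0n (leq_trans _ (m_ge _)).
  rewrite /tt /mm; field.
  by rewrite n0 mn0 nat1r pnatr_eq0.
apply/cvgrPdist_le => e e0.
move/cvgrPdist_le : lo => /(_ _ e0)[K1 _ HK1].
move/cvgrPdist_le : up => /(_ _ e0)[K2 _ HK2].
(* Beyond this time, the least [k] with [n < m k.+1] exceeds both thresholds, and [m k] is
   positive. *)
exists (m (K1 + K2).+1) => // n /= hn.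
have exk : exists k, (n < m k.+1)%N.
  by exists n; exact: m_ge.
case: (ex_minnP exk) => k nk kmin.
have Kk : (K1 + K2 < k)%N.
  rewrite ltnNge; apply/negP => kK.
  have : (m k.+1 <= m (K1 + K2).+1)%N.
    by move: kK; rewrite leq_eqVlt => /orP[/eqP->//|h]; rewrite ltnW// m_lt.
  lia.
have mk : (m k <= n)%N.
  case: k Kk {nk} kmin => // k _ kmin; rewrite leqNgt; apply/negP => h.
  by have := kmin k h; rewrite ltnn.
have mk0 : (0 < m k)%N by rewrite (leq_trans _ (m_ge _))//; lia.
have n0 : (0 < n)%N := leq_trans mk0 mk.
have cE : avg (fun j => (l j)%:R) n = (c n)%:R / n%:R :> R.
  by rewrite /avg /c natr_sum mulrC.
have h1 : (Tk k)%:R / (m k.+1)%:R <= avg (fun j => (l j)%:R) n :> R.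
  rewrite cE ler_pM ?invr_ge0//; first by rewrite ler_nat -cm cS.
  by rewrite lef_pV2 ?posrE ?ltr0n// ?ler_nat ltnW// (leq_trans _ nk).
have h2 : avg (fun j => (l j)%:R) n <= (Tk k.+1)%:R / (m k)%:R :> R.
  rewrite cE ler_pM ?invr_ge0//; first by rewrite ler_nat -cm cS// ltnW.
  by rewrite lef_pV2 ?posrE ?ltr0n// ?ler_nat.
have K1k : (K1 <= k)%N := leq_trans (leq_addr K2 K1) (ltnW Kk).
have := HK1 k K1k; rewrite /= ler_norml => /andP[g1 g2].
have K2k : (K2 <= k)%N := leq_trans (leq_addl K1 K2) (ltnW Kk).
have := HK2 k K2k; rewrite /= ler_norml => /andP[g3 g4].
by rewrite ler_norml; apply/andP; split; lra.
Unshelve. all: by end_near. Qed.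

End runs_of_a_path.

(** * Cylinder events *)

Section process_cylinder_def.
Context {T U : Type}.
Implicit Types (Z : nat -> T -> U) (B : nat -> set U).

Definition process_cyl Z B (n : nat) : set T :=
  [set w | forall k, (2 <= k <= n)%N -> B k (Z k w)].

Lemma process_cyl1 Z B : process_cyl Z B 1 = setT.
Proof. by apply/seteqP; split => // w _ k; lia. Qed.

Lemma process_cylS Z B n : (0 < n)%N ->
  process_cyl Z B n.+1 = process_cyl Z B n `&` Z n.+1 @^-1` B n.+1.
Proof.
move=> n0; apply/seteqP; split => w.
  by move=> h; split => [k kn|]; apply: h; lia.
move=> [h1 h2] k; rewrite (leq_eqVlt k) => /andP[k2 /orP[/eqP->|kn]] //.
by apply: h1; rewrite k2.
Qed.

Lemma eq_process_cyl Z B B' n : (forall k, (2 <= k <= n)%N -> B k = B' k) ->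
  process_cyl Z B n = process_cyl Z B' n.
Proof.
by move=> e; apply/seteqP; split => w h k kn; have := h k kn; rewrite e.
Qed.

Lemma process_cylI Z B B' n :
  process_cyl Z B n `&` process_cyl Z B' n =
  process_cyl Z (fun k => B k `&` B' k) n.
Proof.
apply/seteqP; split => w; first by move=> [h h'] k kn; split; auto.
by move=> h; split => k kn; have [] := h k kn.
Qed.

End process_cylinder_def.

Section cylinders.
Context {R : realType} {d : measure_display} {T : measurableType d}.
Variable P : probability T R.

Lemma g_sigmaI (G : set (set T)) A B :
  <<s G >> A -> <<s G >> B -> <<s G >> (A `&` B).
Proof. exact: (@measurableI _ (g_sigma_algebraType G)). Qed.

Lemma g_sigmaT (G : set (set T)) : <<s G >> setT.
Proof. exact: (@measurableT _ (g_sigma_algebraType G)). Qed.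

Section process_cylinder.
Context {d' : measure_display} {U : measurableType d'}.
Implicit Types (Z : nat -> T -> U) (B : nat -> set U).

Let K := [set k | (2 <= k)%N].

Lemma process_cyl_prob Z B n : mutual_independence P K (fun k => sigma_rv (Z k)) ->
  (forall k, measurable (B k)) -> (0 < n)%N ->
  (P (process_cyl Z B n.+1) = P (process_cyl Z B n) * P (Z n.+1 @^-1` B n.+1))%E.
Proof.
move=> [_ ind] mB n0; pose E k := Z k @^-1` B k.
have [idx in_idx] : exists idx : nat -> {fset nat},
    forall k m, (k \in idx m) = (2 <= k <= m)%N.
  exists (fun m => [fset k in iota 2 m.-1]%fset) => k m.
  by rewrite !inE mem_iota; case: m => [|m] /=; lia.
have cE m : process_cyl Z B m = \bigcap_(k in [set` idx m]) E k.
  by apply/seteqP; split => w h k /=; [rewrite in_idx; exact: h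
    |move=> km; apply: h; rewrite /= in_idx].
have PE m : P (process_cyl Z B m) = (\prod_(k <- idx m) P (E k))%E.
  rewrite cE; apply: ind.
    by move=> k /=; rewrite in_idx => /andP[].
  by move=> k _; exists (B k) => //; rewrite setTI.
have idxS : idx n.+1 = (n.+1 |` idx n)%fset.
  by apply/fsetP => k; rewrite in_fset1U !in_idx; lia.
have nidx : n.+1 \notin idx n by rewrite in_idx ltnn andbF.
by rewrite !PE idxS (big_fsetU1 _ _ nidx)/= muleC.
Qed.

Lemma sigma_process_cyl Z B n : (forall k, measurable (B k)) ->
  sigma_process K Z (process_cyl Z B n).
Proof.
move=> mB.
have sT : sigma_process K Z setT by exact: g_sigmaT.
elim: n => [|[|n] ih].
- rewrite (_ : process_cyl Z B 0 = setT)//.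
  by apply/seteqP; split => // w _ k; lia.
- by rewrite process_cyl1.
rewrite process_cylS//; apply: g_sigmaI => //.
apply: sub_sigma_algebra; exists n.+2 => //.
by exists (B n.+2) => //; rewrite setTI.
Qed.

End process_cylinder.

Lemma ae_prob1 (A : set T) : measurable A -> P A = 1%E -> {ae P, forall w, A w}.
Proof.
move=> mA PA; exists (~` A); split => //; first exact: measurableC.
by rewrite probability_setC// PA subee.
Qed.

End cylinders.

Section tmerw_cylinders.
Context {R : realType} {d : measure_display} {T : measurableType d}.
Variables (P : probability T R) (p lambda : R) (D : nat -> T -> set nat).
Variables (X Y eps : nat -> {RV P >-> R}) (I : nat -> {RV P >-> nat}).
Hypothesis H : is_TMERW p lambda D X Y eps I.

Let K := [set n | (2 <= n)%N].

Lemma indep5 (A0 A1 A2 A3 A4 : set T) :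
  sigma_rv (X 1%N) A0 -> sigma_sets D A1 -> sigma_process K Y A2 ->
  sigma_process K eps A3 -> sigma_process K I A4 ->
  (P (A0 `&` A1 `&` A2 `&` A3 `&` A4) = P A0 * P A1 * P A2 * P A3 * P A4)%E.
Proof.
move=> h0 h1 h2 h3 h4; have [_ ind] := tmerw_indep H.
pose o k : 'I_5 := inord k.
pose E (i : 'I_5) := nth set0 [:: A0; A1; A2; A3; A4] i.
have oE k : (k < 5)%N -> o k = k :> nat by move=> k5; rewrite inordK.
have EE k : (k < 5)%N -> E (o k) = nth set0 [:: A0; A1; A2; A3; A4] k.
  by move=> k5; rewrite /E oE.
have o_neq j k : (j < 5)%N -> (k < 5)%N -> (o j == o k) = (j == k).
  by move=> j5 k5; rewrite -val_eqE/= !oE.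
have n3 : o 3 \notin [fset o 4]%fset by rewrite !inE !o_neq.
have n2 : o 2 \notin (o 3 |` [fset o 4])%fset by rewrite !inE !o_neq.
have n1 : o 1%N \notin (o 2 |` (o 3 |` [fset o 4]))%fset by rewrite !inE !o_neq.
have n0 : o 0%N \notin (o 1%N |` (o 2 |` (o 3 |` [fset o 4])))%fset.
  by rewrite !inE !o_neq.
have := ind (o 0%N |` (o 1%N |` (o 2 |` (o 3 |` [fset o 4]))))%fset E.
rewrite bigcap_fset !(big_fsetU1 _ _ n0, big_fsetU1 _ _ n1, big_fsetU1 _ _ n2,
  big_fsetU1 _ _ n3, big_seq_fset1) /= !EE//= !setIA !muleA; apply => //.
move=> i _; rewrite (tnth_nth set0) /E.
by case: i => -[|[|[|[|[|//]]]]] /=.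
Qed.

(** The level n restricts the innovations only: [BD] may be any event of the whole sequence [D],
    later times included. *)
Definition cyl n (A : set T) : Prop := exists B0 BD BY BE BI,
  [/\ [/\ measurable B0, sigma_sets D BD, forall k, measurable (BY k),
          forall k, measurable (BE k) & forall k, measurable (BI k)]
    & A = X 1%N @^-1` B0 `&` BD `&` process_cyl Y BY n `&`
          process_cyl eps BE n `&` process_cyl I BI n].

Definition innovation n (b e : set R) (i : set nat) : set T :=
  Y n @^-1` b `&` eps n @^-1` e `&` I n @^-1` i.

Let upd {U : Type} (B : nat -> set U) (n : nat) b (k : nat) := if k == n then b else B k.

Let updE {U : Type} (B : nat -> set U) n b : upd B n b n = b.
Proof. by rewrite /upd eqxx. Qed.

Let pc_upd {U : Type} (Z : nat -> T -> U) B n b :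
  process_cyl Z (upd B n.+1 b) n = process_cyl Z B n.
Proof. by apply: eq_process_cyl => k kn; rewrite /upd ifF//; lia. Qed.

Let pc_updS {U : Type} (Z : nat -> T -> U) B n b : (0 < n)%N ->
  process_cyl Z (upd B n.+1 b) n.+1 = process_cyl Z B n `&` Z n.+1 @^-1` b.
Proof. by move=> n0; rewrite process_cylS// pc_upd /upd eqxx. Qed.

Let upd_measurable {d'} {U : measurableType d'} (B : nat -> set U) n b :
  measurable b -> (forall k, measurable (B k)) -> forall k, measurable (upd B n b k).
Proof. by move=> mb mB k; rewrite /upd; case: ifP. Qed.

Lemma cyl_measurable n A : cyl n A -> measurable A.
Proof.
move=> [B0 [BD [BY [BE [BI [[m0 mD mY mE mI] ->]]]]]].
have [sub _] := tmerw_indep H.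
have s (i : 'I_5) := sub i Logic.I.
have s1 := s (inord 1); have s2 := s (inord 2); have s3 := s (inord 3).
have s4 := s (inord 4).
rewrite (tnth_nth set0) inordK//= in s1.
rewrite (tnth_nth set0) inordK//= in s2.
rewrite (tnth_nth set0) inordK//= in s3.
rewrite (tnth_nth set0) inordK//= in s4.
apply: measurableI; last by apply: s4; exact: sigma_process_cyl.
apply: measurableI; last by apply: s3; exact: sigma_process_cyl.
apply: measurableI; last by apply: s2; exact: sigma_process_cyl.
apply: measurableI; last exact: s1.
exact: measurable_funPTI.
Qed.

Lemma cylI n A B : cyl n A -> cyl n B -> cyl n (A `&` B).
Proof.
move=> [B0 [BD [BY [BE [BI [[m0 mD mY mE mI] ->]]]]]].
move=> [C0 [CD [CY [CE [CI [[n0 nD nY nE nI] ->]]]]]].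
exists (B0 `&` C0), (BD `&` CD), (fun k => BY k `&` CY k),
  (fun k => BE k `&` CE k), (fun k => BI k `&` CI k); split.
  split; try by [apply: measurableI|apply: g_sigmaI|move=> k; apply: measurableI].
rewrite -!process_cylI preimage_setI.
by apply/seteqP; split => w /=; tauto.
Qed.

Lemma cyl_innovation n A b e i : (0 < n)%N -> cyl n A ->
  measurable b -> measurable e -> measurable i ->
  cyl n.+1 (A `&` innovation n.+1 b e i).
Proof.
move=> n0 [B0 [BD [BY [BE [BI [[m0 mD mY mE mI] ->]]]]]] mb me mi.
exists B0, BD, (upd BY n.+1 b), (upd BE n.+1 e), (upd BI n.+1 i); split.
  by split => //; apply upd_measurable.
rewrite (pc_updS Y BY b n0) (pc_updS eps BE e n0) (pc_updS I BI i n0) /innovation.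
by apply/seteqP; split => w /=; tauto.
Qed.

Lemma cylS n A : (0 < n)%N -> cyl n A -> cyl n.+1 A.
Proof.
move=> n0 cA; have := @cyl_innovation n A setT setT setT n0 cA.
by rewrite /innovation !preimage_setT !setIT; apply.
Qed.

(** Independence of the past and the innovation at time [n.+1]. The intersection is again a
    cylinder, of level [n.+1]; the rule for the five independent sources splits it, and the rule
    inside each of the three sequences detaches its last factor. *)
Lemma cyl_innovation_prob n A b e i : (0 < n)%N -> cyl n A ->
  measurable b -> measurable e -> measurable i ->
  (P (A `&` innovation n.+1 b e i) =
   P A * (P (Y n.+1 @^-1` b) * P (eps n.+1 @^-1` e) * P (I n.+1 @^-1` i)))%E.
Proof.
move=> n0 [B0 [BD [BY [BE [BI [[m0 mD mY mE mI] ->]]]]]] mb me mi.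
have -> : X 1%N @^-1` B0 `&` BD `&` process_cyl Y BY n `&`
    process_cyl eps BE n `&` process_cyl I BI n `&` innovation n.+1 b e i =
  X 1%N @^-1` B0 `&` BD `&` process_cyl Y (upd BY n.+1 b) n.+1 `&`
    process_cyl eps (upd BE n.+1 e) n.+1 `&` process_cyl I (upd BI n.+1 i) n.+1.
  rewrite (pc_updS Y BY b n0) (pc_updS eps BE e n0) (pc_updS I BI i n0) /innovation.
  by apply/seteqP; split => w /=; tauto.
have x1 : sigma_rv (X 1%N) (X 1%N @^-1` B0) by exists B0 => //; rewrite setTI.
have [iY _] := tmerw_Y_iid H; have [iE _] := tmerw_eps_iid H.
have iI := tmerw_I_indep H.
rewrite !indep5//; try by [apply: sigma_process_cyl|apply: sigma_process_cyl; apply upd_measurable].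
rewrite (process_cyl_prob iY)//; last by apply upd_measurable.
rewrite (process_cyl_prob iE)//; last by apply upd_measurable.
rewrite (process_cyl_prob iI)//.
rewrite (pc_upd Y BY) (pc_upd eps BE) (pc_upd I BI).
rewrite (updE BY) (updE BE) (updE BI).
set u := (P (X 1%N @^-1` B0) * P BD)%E.
by rewrite (muleA u) (muleACA (u * _)%E) (muleACA (u * _ * _)%E).
Qed.

End tmerw_cylinders.

(** * Linear combinations of indicators, up to null sets *)

Section aespan.
Context {R : realType} {d : measure_display} {T : measurableType d}.
Variable P : probability T R.
Implicit Types (C : set (set T)) (f g : T -> R).

Local Notation itg f := (P.-integrable setT (EFin \o f)).

Inductive span C : (T -> R) -> Prop :=
| span0 : span C (fun=> 0)
| span_indic A : C A -> span C \1_A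
| span_lin a f g : span C f -> span C g -> span C (fun w => a * f w + g w).

Lemma span_sub C C' f : C `<=` C' -> span C f -> span C' f.
Proof.
move=> CC; elim=> [|A /CC|a {}f g _ ih1 _ ih2].
- exact: span0.
- exact: span_indic.
- exact: span_lin.
Qed.

(** Indicators multiply by intersecting their events, so stability under intersection makes the span
    an algebra. *)
Lemma span_mul C f g : (forall A B, C A -> C B -> C (A `&` B)) ->
  span C f -> span C g -> span C (fun w => f w * g w).
Proof.
move=> CI sf sg; elim: sf => [|A CA|a {}f f' _ ih1 _ ih2].
- rewrite (_ : (fun _ => _) = fun=> 0); first exact: span0.
  by apply/funext => w; rewrite mul0r.
- elim: sg => [|B CB|b {}g g' _ ih1 _ ih2].
  + rewrite (_ : (fun _ => _) = fun=> 0); first exact: span0.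
    by apply/funext => w; rewrite mulr0.
  + rewrite (_ : (fun _ => _) = \1_(A `&` B)); first exact/span_indic/CI.
    by apply/funext => w; rewrite indicI.
  + rewrite (_ : (fun _ => _) = (fun w => b * (\1_A w * g w) + \1_A w * g' w)).
      exact: span_lin.
    by apply/funext => w; ring.
- rewrite (_ : (fun _ => _) = (fun w => a * (f w * g w) + f' w * g w)).
    exact: span_lin.
  by apply/funext => w; ring.
Qed.

Lemma span_bounded C f : C `<=` measurable -> span C f ->
  measurable_fun setT f /\ exists M, forall w, `|f w| <= M.
Proof.
move=> mC; elim=> [|A /mC mA|a {}f g _ [mf [M fM]] _ [mg [N gN]]].
- by split=> //; exists 0 => w; rewrite normr0.
- split; first exact: measurable_indic.
  by exists 1 => w; rewrite indicE; case: (_ \in _); rewrite ?normr1 ?normr0.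
- split; first by apply: measurable_funD => //; exact: measurable_funM.
  exists (`|a| * M + N) => w; rewrite (le_trans (ler_normD _ _))// lerD//.
  by rewrite normrM ler_wpM2l.
Qed.

Lemma bounded_itg f M : measurable_fun setT f -> (forall w, `|f w| <= M) -> itg f.
Proof.
move=> mf fM; apply: (itg_le mf (g := fun=> M)) => //.
exact: finite_measure_integrable_cst.
Qed.

(** Equality is almost sure because the step recursion yields an expression in indicators only where
    the innovations take their prescribed values. Measurability is recorded apart, as it does not
    pass through almost sure equality. *)
Definition aespan C f := measurable_fun setT f /\
  exists2 g, span C g & {ae P, forall w, f w = g w}.

Lemma ae_expect f g : measurable_fun setT f -> measurable_fun setT g ->
  {ae P, forall w, f w = g w} -> \int[P]_w f w = \int[P]_w g w.
Proof.
move=> mf mg fg; congr fine; apply: ae_eq_integral => //.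
- exact/measurable_EFinP.
- exact/measurable_EFinP.
- by apply: filterS fg => w e _; rewrite /= e.
Qed.

Section closure.
Variable C : set (set T).
Hypothesis CI : forall A B, C A -> C B -> C (A `&` B).
Hypothesis mC : C `<=` measurable.
Hypothesis CT : C setT.

Lemma aespan_itg f : aespan C f -> itg f.
Proof.
move=> [mf [g sg fg]]; have [mg [M gM]] := span_bounded mC sg.
have /integrableP[_ ig] := bounded_itg mg gM.
have mf' : measurable_fun setT (EFin \o f) by exact/measurable_EFinP.
have mg' : measurable_fun setT (EFin \o g) by exact/measurable_EFinP.
apply/integrableP; split=> //; apply: le_lt_trans ig.
rewrite le_eqVlt; apply/orP; left; apply/eqP; apply: ae_eq_integral => //.
- exact: measurableT_comp.
- exact: measurableT_comp.
- by apply: filterS fg => w e _; rewrite /= e.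
Qed.

Lemma aespan_cst a : aespan C (fun=> a).
Proof.
split=> //; exists (fun=> a); last exact: aeW.
rewrite (_ : (fun _ => _) = (fun w => a * \1_setT w + 0)).
  by apply: span_lin; [exact: span_indic|exact: span0].
by apply/funext => w; rewrite indicT mulr1 addr0.
Qed.

Lemma aespan_lin a f g : aespan C f -> aespan C g ->
  aespan C (fun w => a * f w + g w).
Proof.
move=> [mf [f' sf ff]] [mg [g' sg gg]]; split.
  by apply: measurable_funD => //; exact: measurable_funM.
exists (fun w => a * f' w + g' w); first exact: span_lin.
by apply: filterS2 ff gg => w -> ->.
Qed.

Lemma aespan_mul f g : aespan C f -> aespan C g -> aespan C (fun w => f w * g w).
Proof.
move=> [mf [f' sf ff]] [mg [g' sg gg]]; split; first exact: measurable_funM.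
exists (fun w => f' w * g' w); first exact: span_mul.
by apply: filterS2 ff gg => w -> ->.
Qed.

Lemma aespan_indic A : C A -> aespan C \1_A.
Proof.
move=> CA; split; first exact/measurable_indic/mC.
by exists \1_A; [exact: span_indic|exact: aeW].
Qed.

Lemma aespanD f g : aespan C f -> aespan C g -> aespan C (fun w => f w + g w).
Proof.
move=> sf sg; rewrite (_ : (fun _ => _) = (fun w => 1 * f w + g w)).
  exact: aespan_lin.
by apply/funext => w; rewrite mul1r.
Qed.

Lemma aespanZ a f : aespan C f -> aespan C (fun w => a * f w).
Proof. by move=> sf; apply: aespan_mul => //; exact: aespan_cst. Qed.

Lemma aespanB f g : aespan C f -> aespan C g -> aespan C (fun w => f w - g w).
Proof.
move=> sf sg; rewrite (_ : (fun _ => _) = (fun w => (- 1) * g w + f w)).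
  exact: aespan_lin.
by apply/funext => w; ring.
Qed.

Lemma aespan_sum m n (f : nat -> T -> R) :
  (forall k, (m <= k < n)%N -> aespan C (f k)) ->
  aespan C (fun w => \sum_(m <= k < n) f k w).
Proof.
elim: n => [|n ih] sf.
  rewrite (_ : (fun _ => _) = fun=> 0); first exact: aespan_cst.
  by apply/funext => w; rewrite big_geq.
have [mn|nm] := leqP m n; last first.
  rewrite (_ : (fun _ => _) = fun=> 0); first exact: aespan_cst.
  by apply/funext => w; rewrite big_geq.
rewrite (_ : (fun _ => _) = (fun w => \sum_(m <= k < n) f k w + f n w)).
  apply: aespanD; last by apply: sf; rewrite mn ltnSn.
  by apply: ih => k /andP[mk kn]; apply: sf; rewrite mk ltnW.
by apply/funext => w; rewrite big_nat_recr.
Qed.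

Lemma aespan_ae f g : measurable_fun setT f -> {ae P, forall w, f w = g w} ->
  aespan C g -> aespan C f.
Proof.
move=> mf fg [mg [h sh gh]]; split=> //; exists h => //.
by apply: filterS2 fg gh => w -> ->.
Qed.

(** Both sides are linear in [f], so it suffices to treat the indicator of an event of [C], for
    which this is the product rule. *)
Lemma aespan_factor f K k : measurable K ->
  (forall A, C A -> P (A `&` K) = P A * k%:E)%E ->
  aespan C f -> \int[P]_w (f w * \1_K w) = k * \int[P]_w f w.
Proof.
move=> mK CK [mf [g sg fg]]; have [mg _] := span_bounded mC sg.
have m1 : measurable_fun setT (\1_K : T -> R) by exact: measurable_indic.
rewrite (@ae_expect f g)//.
rewrite (@ae_expect (fun w => f w * \1_K w) (fun w => g w * \1_K w)); last 3 first.
- exact: measurable_funM.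
- exact: measurable_funM.
- by apply: filterS fg => w ->.
elim: sg => {f mf fg g mg} [|A CA|a f g sf ih1 sg ih2].
- under eq_Rintegral do rewrite mul0r.
  by rewrite !Rintegral_cst// !mul0r mulr0.
- have -> : \int[P]_w (\1_A w * \1_K w) = \int[P]_w (\1_(A `&` K) w : R).
    by apply: eq_Rintegral => w _; rewrite indicI.
  rewrite /Rintegral !integral_indic//; last 2 first.
  - exact: mC.
  - by apply: measurableI => //; exact: mC.
  rewrite !setIT.
  transitivity (fine (P A * k%:E)%E).
    by have h := CK _ CA; rewrite -h.
  have PA : P A \is a fin_num by apply: fin_num_measure; exact: mC.
  by rewrite fineM// mulrC.
have [mf [M fM]] := span_bounded mC sf.
have [mg [N gN]] := span_bounded mC sg.
have K1 w : `|\1_K w : R| <= 1.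
  by rewrite indicE; case: (_ \in _); rewrite ?normr1 ?normr0.
have if1 := bounded_itg mf fM; have ig1 := bounded_itg mg gN.
have mfK : measurable_fun setT (fun w => f w * \1_K w) by exact: measurable_funM.
have mgK : measurable_fun setT (fun w => g w * \1_K w) by exact: measurable_funM.
have ifK : itg (fun w => f w * \1_K w).
  by apply: (@bounded_itg _ M) => // w; rewrite normrM (le_trans _ (fM w))// ler_piMr.
have igK : itg (fun w => g w * \1_K w).
  by apply: (@bounded_itg _ N) => // w; rewrite normrM (le_trans _ (gN w))// ler_piMr.
have -> : \int[P]_w ((a * f w + g w) * \1_K w) =
    \int[P]_w (a * (f w * \1_K w) + g w * \1_K w).
  by apply: eq_Rintegral => w _; ring.
rewrite expectD//; last exact: (integrableZl measurableT a ifK).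
rewrite expectZ// ih1 ih2 expectD//; last exact: (integrableZl measurableT a if1).
by rewrite expectZ//; ring.
Qed.

End closure.

Lemma aespan_sub C C' f : C `<=` C' -> aespan C f -> aespan C' f.
Proof. by move=> CC [mf [g /(span_sub CC) sg fg]]; split=> //; exists g. Qed.

End aespan.

(** * Increments of the walk *)

Section tmerw_increments.
Context {R : realType} {d : measure_display} {T : measurableType d}.
Variables (P : probability T R) (p lambda : R) (D : nat -> T -> set nat).
Variables (X Y eps : nat -> {RV P >-> R}) (I : nat -> {RV P >-> nat}).
Hypothesis H : is_TMERW p lambda D X Y eps I.
Variable L : nat -> T -> bool.
Hypothesis DL : forall n w, (1 <= n)%N ->
  D n w = [set j | (1 <= j <= n)%N /\ L j w = false].

Local Notation itg f := (P.-integrable setT (EFin \o f)).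

Lemma expect_sum (f : nat -> T -> R) m n :
  (forall k, (m <= k < n)%N -> itg (f k)) ->
  itg (fun w => \sum_(m <= k < n) f k w) /\
  \int[P]_w (\sum_(m <= k < n) f k w) = \sum_(m <= k < n) \int[P]_w f k w.
Proof.
elim: n => [|n ih] fi.
  have -> : (fun w => \sum_(m <= k < 0) f k w) = fun=> 0.
    by apply/funext => w; rewrite big_geq.
  by rewrite [RHS]big_geq// Rintegral_cst// mul0r; split=> //; exact: integrable0.
have [mn|nm] := leqP m n; last first.
  have -> : (fun w => \sum_(m <= k < n.+1) f k w) = fun=> 0.
    by apply/funext => w; rewrite big_geq.
  by rewrite [RHS]big_geq// Rintegral_cst// mul0r; split=> //; exact: integrable0.
have [i1 e1] : itg (fun w => \sum_(m <= k < n) f k w) /\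
    \int[P]_w (\sum_(m <= k < n) f k w) = \sum_(m <= k < n) \int[P]_w f k w.
  by apply: ih => k /andP[mk kn]; apply: fi; rewrite mk ltnW.
have fn : itg (f n) by apply: fi; rewrite mn ltnSn.
have -> : (fun w => \sum_(m <= k < n.+1) f k w) =
    (fun w => \sum_(m <= k < n) f k w + f n w).
  by apply/funext => w; rewrite big_nat_recr.
split; first exact: (integrableD measurableT i1 fn).
by rewrite expectD// [RHS]big_nat_recr//= e1.
Qed.

Let n11 : (1 : R) <> -1.
Proof. by apply/eqP; rewrite -subr_eq0 opprK -mulr2n pnatr_eq0. Qed.

(** This is [Z] where [Z] is 1 or -1, and 0 elsewhere: bounded at every point and a combination of
    two indicators, which [Z] itself need not be. *)
Definition signed (Z : T -> R) (w : T) : R :=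
  \1_(Z @^-1` [set 1]) w - \1_(Z @^-1` [set (-1)]) w.

Lemma signedE (Z : T -> R) w : Z w = 1 \/ Z w = -1 -> signed Z w = Z w.
Proof.
rewrite /signed !indicE /= => -[] e.
  rewrite mem_set//= memNset/= ?subr0//; by rewrite e.
rewrite memNset/=; last by rewrite e => /esym.
by rewrite mem_set//= sub0r e.
Qed.

Lemma signed_le1 (Z : T -> R) w : `|signed Z w| <= 1.
Proof.
rewrite /signed !indicE ler_norml.
by case: (_ \in _); case: (_ \in _); rewrite /=; apply/andP; split; lra.
Qed.

Lemma measurable_signed (Z : {RV P >-> R}) : measurable_fun setT (signed Z).
Proof.
by apply: measurable_funB; apply: measurable_indic; exact: measurable_funPTI.
Qed.

Lemma sign_law_ae (q : R) (Z : {RV P >-> R}) : sign_law P q Z ->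
  {ae P, forall w, Z w = 1 \/ Z w = -1}.
Proof.
move=> [P1 P2].
have m1 : measurable (Z @^-1` [set 1]) by exact: measurable_funPTI.
have m2 : measurable (Z @^-1` [set (-1)]) by exact: measurable_funPTI.
have := @ae_prob1 _ _ _ P (Z @^-1` [set 1] `|` Z @^-1` [set (-1)]).
apply; first exact: measurableU.
rewrite measureU//; last first.
  by apply/seteqP; split => // w [/= -> /n11].
by rewrite /= P1 P2 -EFinD addrC subrK.
Qed.

Definition clipped (k : nat) (w : T) : R := if k is 0 then 0 else signed (X k) w.

Definition mark (k : nat) (w : T) : R := (L k w)%:R.

Let q := 2 * p - 1.
Let m := 2 * lambda - 1.
Let C := cyl D X Y eps I.

Definition drift (n : nat) (w : T) : R :=
  avg (fun j => q * (mark j w * clipped j w) + m * (1 - mark j w)) n.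

Let mC n : C n `<=` measurable.
Proof. by move=> A; exact: cyl_measurable H _ _. Qed.

Let CI n A B : C n A -> C n B -> C n (A `&` B). Proof. exact: cylI. Qed.

Lemma cyl_past n B0 BD : measurable B0 -> sigma_sets D BD ->
  cyl D X Y eps I n (X 1%N @^-1` B0 `&` BD).
Proof.
move=> m0 mD; exists B0, BD, (fun=> setT), (fun=> setT), (fun=> setT); split=> //.
have pT U (Z : nat -> T -> U) : process_cyl Z (fun=> setT) n = setT.
  by apply/seteqP; split.
by rewrite !pT !setIT.
Qed.

Let CT n : C n setT.
Proof.
have sT : sigma_sets D setT by exact: g_sigmaT.
by have := @cyl_past n setT setT measurableT sT; rewrite preimage_setT setIT.
Qed.

Let sp n f := aespan P (C n) f.

Let spS n f : (0 < n)%N -> sp n f -> sp n.+1 f.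
Proof. by move=> n0; apply: aespan_sub => A; exact: cylS. Qed.

Lemma aespan_cyl_le k n f : (0 < k <= n)%N ->
  aespan P (cyl D X Y eps I k) f -> aespan P (cyl D X Y eps I n) f.
Proof.
elim: n => [|n ih]; first by case: k.
move=> /andP[k0]; rewrite leq_eqVlt => /orP[/eqP->//|kn] sk.
apply: spS; first by rewrite (leq_trans k0).
by apply: ih => //; rewrite k0.
Qed.

(** The mark at k is 0 exactly when k lies in [D k]. The level n may be smaller than k, since
    cylinders contain all events of [D]. *)
Lemma aespan_mark n k : (0 < k)%N -> aespan P (cyl D X Y eps I n) (mark k).
Proof.
move=> k0.
have cD : C n [set w | D k w k].
  have := @cyl_past n setT [set w | D k w k] measurableT.
  rewrite preimage_setT setTI; apply.
  by apply: sub_sigma_algebra; exists k, k.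
have -> : mark k = (fun w => 1 - \1_[set w | D k w k] w).
  apply/funext => w; rewrite /mark indicE.
  have -> : (w \in [set w | D k w k]) = ~~ L k w.
    apply/idP/idP => [|Lk]; first by rewrite inE /= DL// => -[_ ->].
    by rewrite inE /= DL//; split; [rewrite k0 leqnn|exact/negbTE].
  by case: (L k w); rewrite ?subr0 ?subrr.
have s1 : aespan P (C n) (fun=> 1) by apply: aespan_cst; exact: CT.
have s2 : aespan P (C n) \1_[set w | D k w k].
  by apply: aespan_indic => //; exact: mC.
exact: aespanB s1 s2.
Qed.

(** Two uses of [aespan_factor], on the events where [s] is 1 and -1. With the masses lambda / n and
    (1 - lambda) / n the difference is m / n; with p / n and (1 - p) / n it is q / n. *)
Lemma sign_factor n (f s : T -> R) (Kp Km : set T) (kp km : R) : C n.+1 Kp -> C n.+1 Km ->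
  (forall A, C n A -> P (A `&` Kp) = P A * kp%:E)%E ->
  (forall A, C n A -> P (A `&` Km) = P A * km%:E)%E ->
  measurable_fun setT s -> {ae P, forall w, s w = \1_Kp w - \1_Km w} ->
  sp n f -> sp n.+1 s /\ \int[P]_w (f w * s w) = (kp - km) * \int[P]_w f w.
Proof.
move=> Cp Cm hp hm ms se sf.
have sp1 : sp n.+1 \1_Kp by apply: aespan_indic => //; exact: mC.
have sm1 : sp n.+1 \1_Km by apply: aespan_indic => //; exact: mC.
have spm : sp n.+1 (fun w => \1_Kp w - \1_Km w) by apply: aespanB.
split; first exact: aespan_ae se spm.
have mf : measurable_fun setT f by case: sf.
have [mp mm] : measurable Kp /\ measurable Km by split; exact: (@mC n.+1).
have i1 A : measurable A -> measurable_fun setT (\1_A : T -> R).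
  by move=> mA; exact: measurable_indic.
rewrite (@ae_expect _ _ _ _ _ (fun w => f w * \1_Kp w + (-1) * (f w * \1_Km w))); last 3 first.
- exact: measurable_funM.
- apply: measurable_funD; first by apply: measurable_funM => //; exact: i1.
  by apply: measurable_funM => //; apply: measurable_funM => //; exact: i1.
- by apply: filterS se => w ->; ring.
have ifK K : measurable K -> itg (fun w => f w * \1_K w).
  move=> mK; have [_ [g sg fg]] := sf.
  have if1 := aespan_itg (@mC n) sf.
  have if2 : itg (fun w => `|f w|) by exact: integrable_abse if1.
  apply: (itg_le _ if2).
    by apply: measurable_funM => //; exact: i1.
  move=> w; rewrite normrM ler_piMr// indicE.
  by case: (_ \in _); rewrite ?normr1 ?normr0.
rewrite expectD//; [|exact: ifK|exact: (integrableZl measurableT (-1) (ifK _ mm))].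
rewrite expectZ; last exact: ifK.
rewrite (aespan_factor (@mC n) mp hp sf) (aespan_factor (@mC n) mm hm sf).
ring.
Qed.

Let PsetT (Z : T -> R) : P (Z @^-1` setT) = 1%E.
Proof. by rewrite preimage_setT probability_setT. Qed.

(* The indicators come from splitting X_(n+1) over the value j of I_(n+1). *)
Lemma innovation_factor n j f : (1 <= j <= n)%N -> sp n f ->
  [/\ sp n.+1 (fun w => \1_(I n.+1 @^-1` [set j]) w * signed (Y n.+1) w),
      sp n.+1 (fun w => \1_(I n.+1 @^-1` [set j]) w * signed (eps n.+1) w),
      \int[P]_w (f w * (\1_(I n.+1 @^-1` [set j]) w * signed (Y n.+1) w)) =
        m * n%:R^-1 * \int[P]_w f w
    & \int[P]_w (f w * (\1_(I n.+1 @^-1` [set j]) w * signed (eps n.+1) w)) =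
        q * n%:R^-1 * \int[P]_w f w].
Proof.
move=> jn sf; have n0 : (0 < n)%N by case/andP: jn => /leq_trans h /h.
have PI := tmerw_I_law H jn.
have [Y1 Y2] := tmerw_Y_law H (n0 : (2 <= n.+1)%N).
have [E1 E2] := tmerw_eps_law H (n0 : (2 <= n.+1)%N).
pose K b e := innovation Y eps I n.+1 b e [set j].
have CK b e : measurable b -> measurable e -> C n.+1 (K b e).
  move=> mb me; have mj : measurable ([set j] : set nat) by [].
  by have := cyl_innovation n0 (@CT n) mb me mj; rewrite setTI.
have PK b e A : measurable b -> measurable e -> C n A ->
    P (A `&` K b e) =
    (P A * (P (Y n.+1 @^-1` b) * P (eps n.+1 @^-1` e) * n%:R^-1%:E))%E.
  move=> mb me cA; rewrite -PI.
  exact: (cyl_innovation_prob H n0 cA mb me).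
have mI : measurable (I n.+1 @^-1` [set j]) by exact: measurable_funPTI.
have mS (Z : {RV P >-> R}) : measurable_fun setT
    (fun w => \1_(I n.+1 @^-1` [set j]) w * signed Z w).
  apply: measurable_funM; last exact: measurable_signed.
  exact: measurable_indic.
have m1 (x : R) : measurable [set x] by exact: measurable_set1.
have mT : measurable [set: R] by exact: measurableT.
have [sY eY] : sp n.+1 (fun w => \1_(I n.+1 @^-1` [set j]) w * signed (Y n.+1) w) /\
    \int[P]_w (f w * (\1_(I n.+1 @^-1` [set j]) w * signed (Y n.+1) w)) =
    (lambda * n%:R^-1 - (1 - lambda) * n%:R^-1) * \int[P]_w f w.
  apply: (@sign_factor n f _ (K [set 1] setT) (K [set (-1)] setT)) => //.
  - exact: CK.
  - exact: CK.
  - by move=> A cA; rewrite PK// Y1 PsetT mule1 -EFinM.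
  - by move=> A cA; rewrite PK// Y2 PsetT mule1 -EFinM.
  - apply: aeW => w.
    by rewrite /K /innovation !preimage_setT !setIT !indicI /= /signed; ring.
have [sE eE] : sp n.+1 (fun w => \1_(I n.+1 @^-1` [set j]) w * signed (eps n.+1) w) /\
    \int[P]_w (f w * (\1_(I n.+1 @^-1` [set j]) w * signed (eps n.+1) w)) =
    (p * n%:R^-1 - (1 - p) * n%:R^-1) * \int[P]_w f w.
  apply: (@sign_factor n f _ (K setT [set 1]) (K setT [set (-1)])) => //.
  - exact: CK.
  - exact: CK.
  - by move=> A cA; rewrite PK// E1 PsetT mul1e -EFinM.
  - by move=> A cA; rewrite PK// E2 PsetT mul1e -EFinM.
  - apply: aeW => w.
    by rewrite /K /innovation !preimage_setT !setTI !indicI /= /signed; ring.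
split=> //; first by rewrite eY /m; congr (_ * _); ring.
by rewrite eE /q; congr (_ * _); ring.
Qed.

Definition regular (w : T) : Prop := (X 1%N w = 1 \/ X 1%N w = -1) /\
  forall n, (1 <= n)%N -> [/\ Y n.+1 w = 1 \/ Y n.+1 w = -1,
    eps n.+1 w = 1 \/ eps n.+1 w = -1 & (1 <= I n.+1 w <= n)%N].

Lemma ae_regular : {ae P, forall w, regular w}.
Proof.
have h n : {ae P, forall w, (1 <= n)%N -> [/\ Y n.+1 w = 1 \/ Y n.+1 w = -1,
    eps n.+1 w = 1 \/ eps n.+1 w = -1 & (1 <= I n.+1 w <= n)%N]}.
  case: n => [|n]; first exact: aeW.
  have aY := sign_law_ae (tmerw_Y_law H (isT : (2 <= n.+2)%N)).
  have aE := sign_law_ae (tmerw_eps_law H (isT : (2 <= n.+2)%N)).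
  (* The law of I gives n + 1 disjoint events of mass 1 / (n + 1), which exhaust the probability. *)
  have aI : {ae P, forall w, (1 <= I n.+2 w <= n.+1)%N}.
    apply: (@ae_prob1 _ _ _ P (I n.+2 @^-1` [set j | (1 <= j <= n.+1)%N])).
      exact: measurable_funPTI.
    have -> : I n.+2 @^-1` [set j | (1 <= j <= n.+1)%N] =
        \big[setU/set0]_(i < n.+1) (I n.+2 @^-1` [set i.+1]).
      rewrite -(bigcup_mkord n.+1 (fun i => I n.+2 @^-1` [set i.+1])); apply/seteqP; split => w /=.
        by move=> /andP[i1 i2]; exists (I n.+2 w).-1 => /=; lia.
      by move=> [i /= i1 ->]; lia.
    pose F i := I n.+2 @^-1` [set i.+1].
    have mF i : measurable (F i) by exact: measurable_funPTI.
    have tF : trivIset setT F.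
      apply/trivIsetP => i j _ _ /eqP ij; apply/seteqP; split => // w [].
      by rewrite /F /= => -> [] /ij.
    transitivity (\sum_(i < n.+1) P (F i))%E; first exact: measure_bigsetU.
    rewrite (eq_bigr (fun=> (n.+1%:R^-1)%:E)); last first.
      by move=> i _; rewrite /F (tmerw_I_law H)//=; case: i.
    rewrite sumEFin sumr_const card_ord -[n.+1%:R^-1 *+ _]mulr_natl divff//.
  by apply: filterS3 aY aE aI => w yw ew iw _; split.
by apply: filterS (ae_foralln h) => w hw; split=> //; exact: (tmerw_first H).
Qed.

Lemma regular_sign w k : regular w -> (1 <= k)%N -> X k w = 1 \/ X k w = -1.
Proof.
move=> [X1 reg]; elim/ltn_ind: k => -[//|[//|k]] ih _.
have [yw ew iw] := reg k.+1 isT.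
have [Dw|Dw] := pselect (D k.+1 w (I k.+2 w)).
  by rewrite (tmerw_step_in H).
rewrite (tmerw_step_out H)//.
have [||->|->] := ih (I k.+2 w); [lia|lia| |].
  by rewrite mulr1.
by rewrite mulrN1; case: ew => ->; rewrite ?opprK; tauto.
Qed.

Lemma clippedE w k : regular w -> (1 <= k)%N -> clipped k w = X k w.
Proof. by case: k => // k rw k0; rewrite /clipped signedE//; exact: regular_sign. Qed.

(** Only the term [j = I n.+1 w] survives. The sum removes the random index from [X (I n.+1 w)], and
    each summand becomes a factor from the past times a factor from the innovation. *)
Lemma clipped_step n w : regular w -> (1 <= n)%N ->
  clipped n.+1 w = \sum_(1 <= j < n.+1)
    (mark j w * clipped j w * (\1_(I n.+1 @^-1` [set j]) w * signed (eps n.+1) w)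
    + (1 - mark j w) * (\1_(I n.+1 @^-1` [set j]) w * signed (Y n.+1) w)).
Proof.
move=> rw n0; have [_ reg] := rw; have [yw ew iw] := reg n n0.
rewrite clippedE// (bigD1_seq (I n.+1 w)) ?iota_uniq//=; last first.
  by rewrite mem_index_iota ltnS.
rewrite big1_seq ?addr0; last first.
  move=> j /andP[jI _]; rewrite indicE memNset/=; last by move=> /eqP; rewrite eq_sym (negbTE jI).
  by rewrite !mul0r !mulr0 addr0.
rewrite indicE mem_set//= !mul1r !signedE// clippedE//; last by case/andP: iw.
rewrite /mark; case LE: (L (I n.+1 w) w).
  rewrite (tmerw_step_out H)//; last by rewrite DL//= LE => -[].
  by rewrite subrr mul0r addr0 mul1r mulrC.
rewrite (tmerw_step_in H)//; last by rewrite DL.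
by rewrite subr0 !mul0r add0r mul1r.
Qed.

Lemma measurable_clipped k : measurable_fun setT (clipped k).
Proof. by case: k => [|k]; [exact: measurable_cst|exact: measurable_signed]. Qed.

Lemma aespan_clipped k : (1 <= k)%N -> sp k (clipped k).
Proof.
elim/ltn_ind: k => -[//|[|k]] ih _.
  have c1 (x : R) : C 1 (X 1%N @^-1` [set x]).
    have sT : sigma_sets D setT by exact: g_sigmaT.
    by have := @cyl_past 1 [set x] setT (measurable_set1 x) sT; rewrite setIT.
  by apply: aespanB; apply: (aespan_indic _ (@mC 1)).
apply: (aespan_ae (measurable_clipped _)).
  by apply: filterS ae_regular => w rw; exact: clipped_step rw _.
apply: aespan_sum => [|j jk]; first exact: CT.
have jk' : (0 < j <= k.+1)%N by lia.
have sc : sp k.+1 (clipped j) by apply: (aespan_cyl_le jk'); apply: ih; lia.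
have [sY sE _ _] := innovation_factor jk' sc.
have sm : sp k.+2 (mark j) by apply: aespan_mark; lia.
have CI2 := @CI k.+2.
apply: aespanD; apply: aespan_mul => //.
  by apply: aespan_mul => //; exact: spS.
by apply: aespanB => //; apply: aespan_cst; exact: CT.
Qed.

(** The weak form of the drift being a conditional mean: it is tested against [G] of level n. Such a
    [G] may contain the mark at [n.+1]. *)
Lemma expect_step n G : (1 <= n)%N -> sp n G ->
  \int[P]_w (G w * clipped n.+1 w) = \int[P]_w (G w * drift n w).
Proof.
move=> n0 sG.
pose F1 j w := G w * (mark j w * clipped j w).
pose F2 j w := G w * (1 - mark j w).
pose sE j w := \1_(I n.+1 @^-1` [set j]) w * signed (eps n.+1) w.
pose sY j w := \1_(I n.+1 @^-1` [set j]) w * signed (Y n.+1) w.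
have CIn := @CI n; have CIS := @CI n.+1.
have s1 j : (1 <= j < n.+1)%N -> sp n (F1 j).
  move=> jn; do 2 (apply: aespan_mul => //).
    by apply: aespan_mark; lia.
  by apply: (@aespan_cyl_le j); [lia|apply: aespan_clipped; lia].
have s2 j : (1 <= j < n.+1)%N -> sp n (F2 j).
  move=> jn; apply: aespan_mul => //; apply: aespanB.
    by apply: aespan_cst; exact: CT.
  by apply: aespan_mark; lia.
have fac1 j : (1 <= j < n.+1)%N -> itg (fun w => F1 j w * sE j w) /\
    \int[P]_w (F1 j w * sE j w) = q * n%:R^-1 * \int[P]_w F1 j w.
  move=> jn; have [_ sE' _ e] := innovation_factor jn (s1 j jn); split=> //.
  apply: (aespan_itg (@mC n.+1)); apply: aespan_mul => //.
  by apply: spS => //; exact: s1.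
have fac2 j : (1 <= j < n.+1)%N -> itg (fun w => F2 j w * sY j w) /\
    \int[P]_w (F2 j w * sY j w) = m * n%:R^-1 * \int[P]_w F2 j w.
  move=> jn; have [sY' _ e _] := innovation_factor jn (s2 j jn); split=> //.
  apply: (aespan_itg (@mC n.+1)); apply: aespan_mul => //.
  by apply: spS => //; exact: s2.
have i1 j : (1 <= j < n.+1)%N -> itg (F1 j).
  by move=> jn; apply: (aespan_itg (@mC n)); exact: s1.
have i2 j : (1 <= j < n.+1)%N -> itg (F2 j).
  by move=> jn; apply: (aespan_itg (@mC n)); exact: s2.
have itgZ a f : itg f -> itg (fun w => a * f w).
  by move=> fi; exact: (integrableZl measurableT a fi).
transitivity (\int[P]_w (\sum_(1 <= j < n.+1) (F1 j w * sE j w + F2 j w * sY j w))).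
  have mG : measurable_fun setT G by case: sG.
  apply: ae_expect.
  - by apply: measurable_funM => //; exact: measurable_clipped.
  - have : sp n.+1 (fun w => \sum_(1 <= j < n.+1) (F1 j w * sE j w + F2 j w * sY j w)).
      apply: aespan_sum => [|j jn]; first exact: CT.
      have [sY' sE' _ _] := innovation_factor jn (s1 j jn).
      by apply: aespanD; apply: aespan_mul => //; apply: spS => //; [exact: s1|exact: s2].
    by case.
  - apply: filterS ae_regular => w rw; rewrite clipped_step// mulr_sumr.
    by apply: eq_bigr => j _; rewrite /F1 /F2 /sE /sY; ring.
have [_ ->] := @expect_sum (fun j w => F1 j w * sE j w + F2 j w * sY j w) 1 n.+1
  (fun j jn => integrableD measurableT (fac1 j jn).1 (fac2 j jn).1).
transitivity (\int[P]_w (\sum_(1 <= j < n.+1)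
    (q * n%:R^-1 * F1 j w + m * n%:R^-1 * F2 j w))); last first.
  apply: eq_Rintegral => w _; rewrite /drift /avg mulrCA mulr_sumr mulr_sumr.
  by apply: eq_bigr => j _; rewrite /F1 /F2; ring.
have [_ ->] := @expect_sum (fun j w => q * n%:R^-1 * F1 j w + m * n%:R^-1 * F2 j w) 1 n.+1
  (fun j jn => integrableD measurableT (itgZ _ _ (i1 j jn)) (itgZ _ _ (i2 j jn))).
apply: eq_big_nat => j jn.
rewrite expectD; [|exact: (fac1 j jn).1|exact: (fac2 j jn).1].
rewrite expectD; [|exact: itgZ (i1 j jn)|exact: itgZ (i2 j jn)].
by rewrite !expectZ ?(fac1 j jn).2 ?(fac2 j jn).2//; [exact: i2|exact: i1].
Qed.

End tmerw_increments.

(** * Convergence of S_n / n *)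

Section tmerw_convergence.
Context {R : realType} {d : measure_display} {T : measurableType d}.
Variables (P : probability T R) (p lambda : R) (D : nat -> T -> set nat).
Variables (X Y eps : nat -> {RV P >-> R}) (I : nat -> {RV P >-> nat}).
Hypothesis H : is_TMERW p lambda D X Y eps I.
Variable L : nat -> T -> bool.
Hypothesis DL : forall n w, (1 <= n)%N ->
  D n w = [set j | (1 <= j <= n)%N /\ L j w = false].

Local Notation itg f := (P.-integrable setT (EFin \o f)).
Local Notation Cyl := (cyl D X Y eps I).
Local Notation Xc := (clipped X).
Local Notation ell := (@mark R _ _ L).
Local Notation dr := (drift p lambda X L).

Let mC n : Cyl n `<=` measurable.
Proof. by move=> A; exact: cyl_measurable H _ _. Qed.

Let CI n A B : Cyl n A -> Cyl n B -> Cyl n (A `&` B). Proof. exact: cylI. Qed.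

Let CT n : Cyl n setT.
Proof.
have sT : sigma_sets D setT by exact: g_sigmaT.
by have := @cyl_past R d T P D X Y eps I n setT setT measurableT sT;
  rewrite preimage_setT setIT.
Qed.

Let sp_le k n f : (0 < k <= n)%N -> aespan P (Cyl k) f -> aespan P (Cyl n) f.
Proof. exact: aespan_cyl_le. Qed.

Let B : R := `|2 * p - 1| + `|2 * lambda - 1| * 2.

Lemma clipped_le1 k w : `|Xc k w| <= 1.
Proof. by case: k => [|k]; rewrite /= ?normr0// signed_le1. Qed.

Lemma mark_le1 k w : `|ell k w| <= 1.
Proof. by rewrite /mark; case: (L k w); rewrite ?normr1 ?normr0. Qed.

Lemma drift_bounded n w : `|dr n w| <= B.
Proof.
apply: avg_le_cst; first by rewrite /B addr_ge0// mulr_ge0.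
move=> k; rewrite (le_trans (ler_normD _ _))// lerD// normrM ?ler_piMr//.
  by rewrite normrM mulr_ile1// ?mark_le1 ?clipped_le1.
rewrite ler_wpM2l// (le_trans (ler_normB _ _))// normr1.
by have := mark_le1 k w; lra.
Qed.

Lemma aespan_drift n : aespan P (Cyl n) (dr n).
Proof.
have CIn := @CI n; have CTn := @CT n.
rewrite (_ : dr n = (fun w => n%:R^-1 * \sum_(1 <= j < n.+1)
  ((2 * p - 1) * (ell j w * Xc j w) + (2 * lambda - 1) * (1 - ell j w))))//.
apply: aespanZ => //; apply: aespan_sum => // j jn.
have sm : aespan P (Cyl n) (ell j) by apply: (aespan_mark H DL); lia.
apply: aespanD; apply: aespanZ => //.
  apply: aespan_mul => //; apply: (@sp_le j); first by lia.
  by apply: (aespan_clipped H DL); lia.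
by apply: aespanB => //; exact: aespan_cst.
Qed.

Section weighted_noise.
Variable c : nat -> T -> R.
Hypothesis c1 : forall k w, `|c k w| <= 1.
Hypothesis sc : forall n k, (0 < k)%N -> aespan P (Cyl n) (c k).

(** The weight [c] is 1 or the mark. It must belong to every level, so that [c n.+1] can join the
    test function at time n. *)
Definition noise (k : nat) (w : T) : R :=
  if k is k'.+1 then c k w * (Xc k w - dr k' w) else 0.

Lemma aespan_noise k : (0 < k)%N -> aespan P (Cyl k) (noise k).
Proof.
case: k => // k _; have CIk := @CI k.+1.
apply: aespan_mul => //; first exact: sc.
apply: aespanB; first exact: (aespan_clipped H DL).
case: k CIk => [|k] CIk; last by apply: (@sp_le k.+1); [lia|exact: aespan_drift].
rewrite (_ : dr 0 = fun=> 0); first by apply: aespan_cst; exact: CT.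
by apply/funext => w; rewrite /drift avg0.
Qed.

Lemma noise_bounded k w : `|noise k w| <= 1 + B.
Proof.
have B0 : 0 <= B := le_trans (normr_ge0 _) (drift_bounded 0 w).
case: k => [|k]; first by rewrite normr0 addr_ge0.
rewrite normrM (@le_trans _ _ (1 * `|Xc k.+1 w - dr k w|))//.
  by rewrite ler_wpM2r.
rewrite mul1r (le_trans (ler_normB _ _))// lerD//; first exact: clipped_le1.
exact: drift_bounded.
Qed.

Lemma avg_noise_cvg : {ae P, forall w, avg (fun k => noise k w) @ \oo --> (0 : R)}.
Proof.
have mN k : measurable_fun setT (noise k).
  by case: k => [|k]; [exact: measurable_cst|have [] := @aespan_noise k.+1 isT].
have N2 k w : `|noise k w ^+ 2| <= (1 + B) ^+ 2.
  rewrite normrX lerXn2r// ?nnegrE ?noise_bounded//.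
  by rewrite (le_trans (normr_ge0 (noise 0 w)))// noise_bounded.
have iN k : itg (fun w => noise k w ^+ 2).
  by apply: bounded_itg (N2 k); exact: measurable_funX.
apply: (@slln_orthogonal R d T P noise ((1 + B) ^+ 2) mN iN _ _ (1 + B)).
- move=> k; have <- : \int[P]_w ((fun=> (1 + B) ^+ 2) w) = (1 + B) ^+ 2 :> R.
    rewrite Rintegral_cst// -[RHS]mulr1; congr (_ * _).
    have h := @probability_setT _ _ _ P; exact: (f_equal (@fine R) h).
  apply: le_Rintegral => //; first exact: finite_measure_integrable_cst.
  by move=> w _; rewrite (le_trans (ler_norm _)).
(* The later index is [n.+1] with n >= i >= 1, so [noise 1], which is not centred as X_1 has an
   arbitrary law, only ever occurs as the earlier factor. *)
- move=> i [|n] /andP[i0 //]; rewrite ltnS => ni.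
  have n0 : (0 < n)%N := leq_trans i0 ni.
  have CIn := @CI n; have CIS := @CI n.+1.
  pose G w := noise i w * c n.+1 w.
  have sG : aespan P (Cyl n) G.
    apply: aespan_mul => //; last exact: sc.
    by apply: (@sp_le i); [lia|exact: aespan_noise].
  have i1 : itg (fun w => G w * Xc n.+1 w).
    apply: (aespan_itg (@mC n.+1)); apply: aespan_mul => //.
      by apply: (@sp_le n) => //; lia.
    exact: (aespan_clipped H DL).
  have i2 : itg (fun w => G w * dr n w).
    apply: (aespan_itg (@mC n)); apply: aespan_mul => //.
    exact: aespan_drift.
  transitivity (\int[P]_w (G w * Xc n.+1 w - G w * dr n w)).
    by apply: eq_Rintegral => w _; rewrite /G /noise; ring.
  by rewrite RintegralB// (expect_step H DL n0 sG) subrr.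
- by move=> k w; have := noise_bounded k w; rewrite ler_norml => /andP[].
Qed.

End weighted_noise.

Hypothesis p01 : 0 <= p <= 1.

(** The density [al] is quantified inside the almost sure statement: the exceptional set comes from
    the noises and the innovations alone, and the density is supplied on each trajectory
    afterwards. *)
Lemma avg_walk_cvg : {ae P, forall w, regular X Y eps I w /\
  forall al : R, 0 <= al < 1 -> avg (fun j => ell j w) @ \oo --> al ->
  avg (fun j => Xc j w) @ \oo -->
    (2 * lambda - 1) * (1 - al) / (1 - al * (2 * p - 1))}.
Proof.
have h1 : {ae P, forall w,
    avg (fun k => noise (fun _ _ => 1) k w) @ \oo --> (0 : R)}.
  apply: avg_noise_cvg => [k w|n k k0]; first by rewrite normr1.
  by apply: aespan_cst; exact: CT.
have h2 : {ae P, forall w, avg (fun k => noise ell k w) @ \oo --> (0 : R)}.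
  apply: avg_noise_cvg => [k w|n k k0]; first exact: mark_le1.
  exact: (aespan_mark H DL).
apply: filterS3 (ae_regular H) h1 h2 => w rw w1 w2; split=> // al al01 mal.
apply: (cvg_avg_tampered (l := fun j => ell j w)) => //.
- by move=> k; exact: mark_le1.
- by move=> k; exact: clipped_le1.
- by rewrite ler_norml; move: p01 => /andP[p0 p1]; apply/andP; split; lra.
- apply: cvg_trans w1; apply: near_eq_cvg; near=> n; apply: eq_avg => -[//|k] _.
  by rewrite /noise mul1r.
- by apply: cvg_trans w2; apply: near_eq_cvg; near=> n; apply: eq_avg => -[//|k] _.
Unshelve. all: by end_near. Qed.

Lemma walkE w n : regular X Y eps I w ->
  walk X n w = n%:R * avg (fun j => Xc j w) n.
Proof.
move=> rw; rewrite natr_avg /walk big_nat_cond [RHS]big_nat_cond.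
by apply: eq_bigr => k /andP[/andP[k1 _] _]; rewrite (clippedE H).
Qed.

End tmerw_convergence.

(** * Divergence and finite level sets *)

Section divergence.
Context {R : realType}.

Lemma cvg_avg_pinfty (u : nat -> R) (g : R) : 0 < g -> avg u @ \oo --> g ->
  (fun n => n%:R * avg u n) @ \oo --> +oo.
Proof.
move=> g0 ug; apply/cvgryPge => A.
have g2 : 0 < g / 2 by rewrite divr_gt0.
move/cvgrPdist_le : ug => /(_ _ g2) ug.
near=> n.
have h : `|g - avg u n| <= g / 2 by near: n.
have h1 : g / 2 <= avg u n by move: h; rewrite ler_norml => /andP[_]; lra.
rewrite (@le_trans _ _ (n%:R * (g / 2)))//; last by rewrite ler_wpM2l.
rewrite -ler_pdivrMr//; near: n; exact: nbhs_infty_ger.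
Unshelve. all: by end_near. Qed.

Lemma cvg_avg_ninfty (u : nat -> R) (g : R) : g < 0 -> avg u @ \oo --> g ->
  (fun n => n%:R * avg u n) @ \oo --> -oo.
Proof.
move=> g0 ug.
have uN n : avg (fun k => - u k) n = - avg u n by rewrite /avg sumrN mulrN.
have Ng : avg (fun k => - u k) @ \oo --> - g.
  by rewrite (_ : avg _ = - avg u); [exact: cvgN|apply/funext => n; rewrite uN].
apply/cvgrNyPle => A.
have Ng0 : 0 < - g by rewrite oppr_gt0.
move/cvgryPge : (cvg_avg_pinfty Ng0 Ng) => /(_ (- A)).
by apply: filterS => n; rewrite uN mulrN lerN2.
Qed.

Lemma finite_level_pinfty (S : nat -> R) x : S @ \oo --> +oo ->
  finite_set [set n | S n = x].
Proof.
move=> /cvgryPge/(_ (x + 1))[N _ HN].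
apply: (@sub_finite_set _ _ `I_N); last exact: finite_II.
move=> n /= Sn; rewrite ltnNge; apply/negP => /HN /=.
by rewrite Sn; lra.
Qed.

Lemma finite_level_ninfty (S : nat -> R) x : S @ \oo --> -oo ->
  finite_set [set n | S n = x].
Proof.
move=> /cvgrNyPle/(_ (x - 1))[N _ HN].
apply: (@sub_finite_set _ _ `I_N); last exact: finite_II.
move=> n /= Sn; rewrite ltnNge; apply/negP => /HN /=.
by rewrite Sn; lra.
Qed.

End divergence.

Theorem corollary1p9 (R : realType) (d : measure_display)
    (T : measurableType d) (P : probability T R) (p lambda : R)
    (D : nat -> T -> set nat) (X Y eps : nat -> {RV P >-> R})
    (I : nat -> {RV P >-> nat}) :
  0 <= p <= 1 -> 0 <= lambda <= 1 ->
  is_TMERW p lambda D X Y eps I ->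
  nested_renewal P D ->
  [/\ 1 / 2 < lambda -> {ae P, forall w, walk X n w @[n --> \oo] --> +oo},
      lambda < 1 / 2 -> {ae P, forall w, walk X n w @[n --> \oo] --> -oo}
    & lambda != 1 / 2 -> transient P (walk X)].
Proof.
move=> p01 l01 H [L [L1 DL [iidt iids _] [mt ms]]].
have [a slln_t] := slln_iid iidt mt.
have [b slln_s] := slln_iid iids ms.
(* The limit is written as 2 lambda - 1 times a positive g, so that one statement serves both
   signs. *)
have core : {ae P, forall w, exists2 g : R, 0 < g &
    walk X ^~ w = (fun n => n%:R * avg (fun j => clipped X j w) n) /\
    avg (fun j => clipped X j w) @ \oo --> (2 * lambda - 1) * g}.
  have fin : {ae P, forall w, forall k, (0 < k)%N ->
      (run_tau (L ^~ w) k < +oo :> \bar R)%E /\ (run_sigma (L ^~ w) k < +oo :> \bar R)%E}.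
    apply: filterS2 (iid_lt_pinfty iidt mt) (iid_lt_pinfty iids ms) => w h1 h2 k k0.
    by split; [exact: h1|exact: h2].
  have aslln : {ae P, forall w,
      avg (fun k => absf (run_tau (L ^~ w) k)) @ \oo --> a /\
      avg (fun k => absf (run_sigma (L ^~ w) k)) @ \oo --> b}.
    by apply: filterS2 slln_t slln_s.
  apply: filterS3 fin aslln (avg_walk_cvg H DL p01).
  move=> w fts [ct cs] [rw conv].
  have ft k (k0 : (0 < k)%N) := proj1 (fts k k0).
  have fs k (k0 : (0 < k)%N) := proj2 (fts k k0).
  have [a1 b1 dens] := cvg_run_density (L1 w) ft fs ct cs.
  have ab0 : 0 < a + b by lra.
  (* The inequality is strict because b >= 1. *)
  have al01 : 0 <= a / (a + b) < 1.
    by rewrite divr_ge0 ?ltr_pdivrMr//; lra.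
  (* The denominator is positive since al q <= al < 1, as q = 2 p - 1 is at most 1. *)
  exists ((1 - a / (a + b)) / (1 - a / (a + b) * (2 * p - 1))).
    case/andP: al01 => al0 al1; rewrite divr_gt0 ?subr_gt0//.
    case/andP: p01 => p0 p1; rewrite (le_lt_trans _ al1)// ler_piMr//; lra.
  split; last by rewrite mulrA; exact: conv.
  by apply/funext => n; exact: (walkE H).
have pos : 1 / 2 < lambda -> {ae P, forall w, walk X n w @[n --> \oo] --> +oo}.
  move=> l2; apply: filterS core => w [g g0 [-> c]].
  by apply: cvg_avg_pinfty c; rewrite mulr_gt0//; lra.
have neg : lambda < 1 / 2 -> {ae P, forall w, walk X n w @[n --> \oo] --> -oo}.
  move=> l2; apply: filterS core => w [g g0 [-> c]].
  by apply: cvg_avg_ninfty c; rewrite pmulr_llt0//; lra.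
split=> //; rewrite /transient neq_lt => /orP[/neg|/pos]; apply: filterS => w c z.
  exact: finite_level_ninfty c.
exact: finite_level_pinfty c.
Qed.
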